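(* Let $K,G,m_0,A_g,B_g,\bar f_c,\bar f_t>0$, $e\in[0.5,1]$, $m_g'(p)=A_g e^{\frac{p-\bar f_t/3}{B_g\bar f_c}}$, $\hat f(p,\varrho,\varrho_e)=\frac32\left(\frac{\varrho}{\bar f_c}\right)^2+m_0\left(\frac{\varrho_e}{\sqrt6\bar f_c}+\frac{p}{\bar f_c}\right)-1$, and $\mathbb D_e=K\mathbf I\otimes\mathbf I+2G\mathbb I_{dev}$. Fix $\boldsymbol\varepsilon^p_{k-1}\in\mathbb R^{3\times3}_{sym}$. For $\boldsymbol\varepsilon\in\mathbb R^{3\times3}_{sym}$ let $\boldsymbol\sigma^{tr}=\mathbb D_e:(\boldsymbol\varepsilon-\boldsymbol\varepsilon^p_{k-1})$ and define $\mathbf T(\boldsymbol\varepsilon)=\boldsymbol\sigma^{tr}$ if $\hat f(p(\boldsymbol\sigma^{tr}),\varrho(\boldsymbol\sigma^{tr}),\varrho_e(\boldsymbol\sigma^{tr}))\le0$, and otherwise $\mathbf T(\boldsymbol\varepsilon)=\boldsymbol\sigma$, where $(\boldsymbol\sigma,\triangle\lambda)$ is the unique solution of: $\boldsymbol\sigma=\boldsymbol\sigma^{tr}-\triangle\lambda\big[K\frac{m_g'(p(\boldsymbol\sigma))}{\bar f_c}\mathbf I+2G\big(\frac{3\varrho(\boldsymbol\sigma)}{\bar f_c^2}+\frac{m_0}{\sqrt6\bar f_c}\big)\hat{\mathbf n}\big]$ for some $\hat{\mathbf n}\in\partial\varrho(\boldsymbol\sigma)$, $\triangle\lambda\ge0$,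 $\hat f(p(\boldsymbol\sigma),\varrho(\boldsymbol\sigma),\varrho_e(\boldsymbol\sigma))\le0$, $\triangle\lambda\,\hat f(p(\boldsymbol\sigma),\varrho(\boldsymbol\sigma),\varrho_e(\boldsymbol\sigma))=0$. Then $\mathbf T$ is strongly semismooth on $\mathbb R^{3\times3}_{sym}$ as a function of $\boldsymbol\varepsilon$.
   Context: $\mathbb R^{3\times3}_{sym}$: real symmetric $3\times3$ matrices with Frobenius product '':'' and norm; $\mathbf I$ identity; $\mathbb I_{dev}:\boldsymbol\sigma=\boldsymbol\sigma-\frac13(\mathbf I:\boldsymbol\sigma)\mathbf I$, $(\mathbf I\otimes\mathbf I):\boldsymbol\sigma=(\mathbf I:\boldsymbol\sigma)\mathbf I$. $p(\boldsymbol\sigma)=\frac13\mathbf I:\boldsymbol\sigma$, $\mathbf s(\boldsymbol\sigma)=\mathbb I_{dev}:\boldsymbol\sigma$, $\varrho(\boldsymbol\sigma)=\|\mathbf s(\boldsymbol\sigma)\|$; for $\varrho(\boldsymbol\sigma)>0$, $\theta(\boldsymbol\sigma)=\frac13\arccos\big(\frac{3\sqrt3}{2}J_3/J_2^{3/2}\big)$ with $J_2=\frac12\mathbf s:\mathbf s$, $J_3=\frac13\mathbf s^3:\mathbf I$. $r_e(\cos\theta)=\frac{4(1-e^2)\cos^2\theta+(2e-1)^2}{2(1-e^2)\cos\theta+(2e-1)\sqrt{4(1-e^2)\cos^2\theta+5e^2-4e}}$; $\varrho_e(\boldsymbol\sigma)=\varrho(\boldsymbol\sigma)r_e(\cos\theta(\boldsymbol\sigma))$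 if $\varrho(\boldsymbol\sigma)>0$ and $0$ otherwise. $\partial\varrho(\boldsymbol\sigma)=\{\mathbf s(\boldsymbol\sigma)/\varrho(\boldsymbol\sigma)\}$ if $\varrho(\boldsymbol\sigma)>0$, and $\{\hat{\mathbf n}\in\mathbb R^{3\times3}_{sym}:\mathbf I:\hat{\mathbf n}=0,\|\hat{\mathbf n}\|\le1\}$ if $\varrho(\boldsymbol\sigma)=0$. A function $F$ between finite-dimensional spaces is strongly semismooth at $x$ if it is locally Lipschitz near $x$, directionally differentiable at $x$, and $F(x+h)-F(x)-Vh=O(\|h\|^2)$ for all $V\in\partial F(x+h)$ (Clarke generalized Jacobian) as $h\to0$; strongly semismooth on a set if at every point. *)

(* Defs.v *)
From HB Require Import structures.
From mathcomp Require Import all_boot all_order all_algebra.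
From mathcomp Require Import boolp reals sequences exp trigo.
Set Implicit Arguments. Unset Strict Implicit. Unset Printing Implicit Defensive.
Import Order.TTheory GRing.Theory Num.Theory.
Local Open Scope ring_scope.

Section Defs.
Variable R : realType.
Notation M := 'M[R]_3.

Definition symm (A : M) : Prop := A^T = A.
Definition fdot (A B : M) : R := \sum_(i < 3) \sum_(j < 3) A i j * B i j.
Definition fnorm (A : M) : R := Num.sqrt (fdot A A).
Definition Id3 : M := 1%:M.

Definition pres (s : M) : R := (fdot Id3 s) / 3.
Definition dev (s : M) : M := s - (pres s) *: Id3.
Definition rho (s : M) : R := fnorm (dev s).
Definition J2 (s : M) : R := (fdot (dev s) (dev s)) / 2.
Definition J3 (s : M) : R := (fdot (dev s *m dev s *m dev s) Id3) / 3.
Definition lode (s : M) : R :=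
  acos ((3 * Num.sqrt 3 / 2) * J3 s / (J2 s * Num.sqrt (J2 s))) / 3.
Definition r_e (e c : R) : R :=
  (4 * (1 - e ^+ 2) * c ^+ 2 + (2 * e - 1) ^+ 2) /
  (2 * (1 - e ^+ 2) * c +
   (2 * e - 1) * Num.sqrt (4 * (1 - e ^+ 2) * c ^+ 2 + 5 * e ^+ 2 - 4 * e)).
Definition rho_e (e : R) (s : M) : R :=
  if 0 < rho s then rho s * r_e e (cos (lode s)) else 0.

(* subdifferential of rho at s (elements of R^{3x3}_sym) *)
Definition subrho (s n : M) : Prop :=
  if 0 < rho s then n = (rho s)^-1 *: dev s
  else symm n /\ fdot Id3 n = 0 /\ fnorm n <= 1.

Definition mg' (Ag Bg fc ft p : R) : R := Ag * expR ((p - ft / 3) / (Bg * fc)).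
Definition fhat (m0 fc p r re : R) : R :=
  3 / 2 * (r / fc) ^+ 2 + m0 * (re / (Num.sqrt 6 * fc) + p / fc) - 1.
Definition fhat_s (m0 fc e : R) (s : M) : R := fhat m0 fc (pres s) (rho s) (rho_e e s).
Definition De (K G : R) (x : M) : M := (K * fdot Id3 x) *: Id3 + (2 * G) *: dev x.

Definition rm_system (K G m0 Ag Bg fc ft e : R) (str s : M) (dl : R) : Prop :=
  symm s /\
  (exists n, subrho s n /\
     s = str - dl *: ((K * mg' Ag Bg fc ft (pres s) / fc) *: Id3
                      + (2 * G * (3 * rho s / fc ^+ 2 + m0 / (Num.sqrt 6 * fc))) *: n)) /\
  0 <= dl /\ fhat_s m0 fc e s <= 0 /\ dl * fhat_s m0 fc e s = 0.

Definition sig_tr (K G : R) (epp eps : M) : M := De K G (eps - epp).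

(* The map T; in the plastic case it returns the (unique, see theorem) solution,
   selected by classical choice. *)
Definition Tmap (K G m0 Ag Bg fc ft e : R) (epp eps : M) : M :=
  let str := sig_tr K G epp eps in
  if fhat_s m0 fc e str <= 0 then str
  else match pselect (exists s, exists dl, rm_system K G m0 Ag Bg fc ft e str s dl) with
       | left h => projT1 (cid h)
       | right _ => 0
       end.

Definition seq_cvg (u : nat -> M) (a : M) : Prop :=
  forall eps : R, 0 < eps -> exists N, forall n, (N <= n)%N -> fnorm (u n - a) < eps.

Definition locally_lipschitz (F : M -> M) (x : M) : Prop :=
  exists d L : R, 0 < d /\ forall y z, symm y -> symm z ->
    fnorm (y - x) < d -> fnorm (z - x) < d -> fnorm (F y - F z) <= L * fnorm (y - z).

Definition dir_differentiable (F : M -> M) (x : M) : Prop :=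
  forall h, symm h -> exists l : M, forall eps : R, 0 < eps -> exists d : R, 0 < d /\
    forall t : R, 0 < t -> t < d -> fnorm (t^-1 *: (F (x + t *: h) - F x) - l) < eps.

Definition linear_on_sym (L : M -> M) : Prop :=
  forall (a : R) h k, symm h -> symm k -> L (a *: h + k) = a *: L h + L k.

Definition frechet_at (F : M -> M) (y : M) (L : M -> M) : Prop :=
  linear_on_sym L /\
  forall eps : R, 0 < eps -> exists d : R, 0 < d /\ forall h, symm h ->
    fnorm h < d -> fnorm (F (y + h) - F y - L h) <= eps * fnorm h.

Definition B_jac (F : M -> M) (x : M) (V : M -> M) : Prop :=
  exists (xs : nat -> M) (Ls : nat -> M -> M),
    (forall k, symm (xs k)) /\ seq_cvg xs x /\
    (forall k, frechet_at F (xs k) (Ls k)) /\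
    (forall h, symm h -> seq_cvg (fun k => Ls k h) (V h)).

(* Clarke generalized Jacobian: convex hull of the B-subdifferential
   (maps are identified by their action on R^{3x3}_sym) *)
Definition clarke_jac (F : M -> M) (x : M) (V : M -> M) : Prop :=
  exists (n : nat) (Vs : 'I_n -> M -> M) (w : 'I_n -> R),
    (forall i, B_jac F x (Vs i)) /\ (forall i, 0 <= w i) /\ \sum_(i < n) w i = 1 /\
    (forall h, symm h -> V h = \sum_(i < n) w i *: Vs i h).

Definition strongly_semismooth_at (F : M -> M) (x : M) : Prop :=
  locally_lipschitz F x /\ dir_differentiable F x /\
  exists C d : R, 0 < d /\ forall h V, symm h -> fnorm h < d ->
    clarke_jac F (x + h) V -> fnorm (F (x + h) - F x - V h) <= C * fnorm h ^+ 2.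

Definition strongly_semismooth_on_sym (F : M -> M) : Prop :=
  forall x, symm x -> strongly_semismooth_at F x.

End Defs.

(* Main.v *)
(** Strong semismoothness is replaced by a stronger property that composes: near x the
    map F is Lipschitz and one-sided directionally differentiable, and
    F'(y; y - x) = F y - F x + O(|y - x|^2) at every y near x, whether or not F is
    differentiable at y. It is inherited by sums, products, compositions with C^{1,1}
    functions, homogeneous functions at their apex, and solutions of scalar equations
    that are strongly monotone in the unknown. At points y where F is differentiable it
    is the required estimate for the Frechet derivative, which survives limits and
    convex combinations.

    A solution of the return-mapping system has the trial direction of the deviator, so
    that only scalars are unknown. With the mean stress p as unknown, the multiplier is
    (p_tr - p) / (K m_g'(p) / f_c), and the yield function becomes increasing in p with
    slope at least m_0 / f_c. The Lode angle enters through cos(theta), a multiple of the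
    largest eigenvalue of the deviator divided by rho; this eigenvalue is a maximum of
    linear functionals, which gives the property above without any case distinction on
    multiplicities. At rho = 0 the data are positively homogeneous of degree one. *)
Require Import Defs.
From HB Require Import structures.
From mathcomp Require Import all_boot all_order all_algebra.
From mathcomp Require Import boolp classical_sets reals prodnormedzmodule topology.
From mathcomp Require Import normedtype sequences exp trigo.
From mathcomp Require Import ring lra.
Set Implicit Arguments. Unset Strict Implicit. Unset Printing Implicit Defensive.
Import Order.TTheory GRing.Theory Num.Theory.
Import numFieldNormedType.Exports.
Local Open Scope ring_scope.

(** * Directional estimates and their calculus *)

(* Proves equalities in abelian groups by cancelling pairs of opposite terms. *)
Ltac zmod_ring :=
  apply/eqP; rewrite -subr_eq0;
  match goal with |- is_true (?l == _) => rewrite -[l]add0r end;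
  rewrite ?(opprB, opprD, opprK, oppr0, addr0, addrA);
  repeat match goal with
  | |- context [ - ?a ] =>
      do 12? rewrite [_ + a + _]addrAC; do 12? rewrite [_ - a + _]addrAC; rewrite addrK
  end; rewrite ?eqxx //.

(** Chain rules for Clarke Jacobians are inclusions only, and an inner function need not be
    differentiable where the composite is; one-sided derivatives of Lipschitz maps compose exactly.
    The calculus applies because one formula covers all regimes. With l the positive part of the
    multiplier, the flow rule solved for the norm of the deviator gives rho = (rho_tr - b l)^+ / (1
    + c l): the outer positive part accounts for the return to the apex, and l = 0 for the elastic
    response. The yield function of this stress makes sense for every mean stress p and every trial
    stress, and comparing its root with the trial mean stress replaces the elastic test. The
    remaining obstacle is the hydrostatic axis, where the Lode angle and the direction of the
    deviator jump. They occur only multiplied by the positive part above, which is at most rho_tr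
    and compensates their derivatives of order 1 / rho_tr. Off the axis, the arccosine is still not
    Lipschitz at the ends of its interval, that is at double eigenvalues; this is why the largest
    eigenvalue is used instead. *)

Section Semismooth.
Context {R : realType}.
Implicit Types U V W : normedModType R.

Definition dirderiv {V W} (F : V -> W) (y h : V) (d : W) : Prop :=
  forall eps : R, 0 < eps -> exists2 r : R, 0 < r &
    forall t, 0 < t -> t < r -> `|F (y + t *: h) - F y - t *: d| <= eps * t.

Definition lip_on {V W} (F : V -> W) (x : V) (r C : R) : Prop :=
  forall y z, `|y - x| < r -> `|z - x| < r -> `|F y - F z| <= C * `|y - z|.

Definition semis_in {V W} (F : V -> W) (x : V) (r C : R) : Prop :=
  lip_on F x r C /\
  forall y, `|y - x| < r ->
    (forall h, exists d, dirderiv F y h d) /\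
    exists2 d, dirderiv F y (y - x) d & `|F y - F x - d| <= C * `|y - x| ^+ 2.

(* Unlike strong semismoothness, the quadratic estimate is required at every
   point y near x, with the one-sided derivative of F at y along y - x; this
   makes the notion stable under composition without any Jacobian. *)
Definition semis {V W} (F : V -> W) (x : V) : Prop :=
  exists r C, [/\ 0 < r, 0 < C & semis_in F x r C].

Lemma semis_inW V W (F : V -> W) x r C r' C' :
  r' <= r -> C <= C' -> semis_in F x r C -> semis_in F x r' C'.
Proof.
move=> rr CC [L S]; split=> [y z yr zr|y yr].
  apply: le_trans (L y z (lt_le_trans yr rr) (lt_le_trans zr rr)) _.
  exact: ler_wpM2r.
have [D [d Dd dC]] := S y (lt_le_trans yr rr).
split=> //; exists d => //; apply: le_trans dC _.
by apply: ler_wpM2r => //; exact: exprn_ge0.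
Qed.

Lemma semis_ddiff V W (F : V -> W) x h : semis F x -> exists d, dirderiv F x h d.
Proof.
by move=> [r [C [r0 C0 [_ S]]]]; apply: (S x _).1; rewrite subrr normr0.
Qed.

Lemma dirderiv_uniq V W (F : V -> W) y h d d' :
  dirderiv F y h d -> dirderiv F y h d' -> d = d'.
Proof.
move=> Hd Hd'; apply/eqP; rewrite -subr_eq0 -normr_le0; apply/ler_addgt0Pr => e e0; rewrite add0r.
have e20 : 0 < e / 2 by lra.
have [r r0 Hr] := Hd _ e20; have [r' r'0 Hr'] := Hd' _ e20.
pose t := Num.min r r' / 2.
have t0 : 0 < t by rewrite divr_gt0// lt_min r0.
have m0 : 0 < Num.min r r' by rewrite lt_min r0.
have tm : t < Num.min r r' by rewrite /t; lra.
move: tm; rewrite lt_min => /andP[tr tr'].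
have := Hr t t0 tr; have := Hr' t t0 tr'.
set A := F (y + t *: h) - F y => H1 H2.
have : `|t *: (d - d')| <= e * t.
  rewrite scalerBr; apply: le_trans (ler_distD A _ _) _.
  rewrite distrC; lra.
by rewrite normrZ gtr0_norm// mulrC ler_pM2r.
Qed.

Lemma ball_shrink V (x y : V) (r : R) : `|y - x| < r ->
  exists2 r', 0 < r' & forall z, `|z - y| < r' -> `|z - x| < r.
Proof.
move=> yr; exists (r - `|y - x|); first by rewrite subr_gt0.
move=> z zy; apply: le_lt_trans (ler_distD y z x) _; lra.
Qed.

Lemma line_near V (y h : V) (r : R) : 0 < r ->
  exists2 r', 0 < r' & forall t, 0 < t -> t < r' -> `|(y + t *: h) - y| < r.
Proof.
move=> r0; have n0 : 0 < `|h| + 1 by apply: ltr_wpDl.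
exists (r / (`|h| + 1)); first by rewrite divr_gt0.
move=> t t0; rewrite ltr_pdivlMr// => tr.
rewrite addrC addKr normrZ gtr0_norm//; apply: le_lt_trans tr.
rewrite ler_wpM2l//; lra.
Qed.

(** Difference quotients along h and h' with the same step t differ by at most C |h - h'|, and this
    passes to the limit. It stands in for linearity of the derivative in the direction. *)
Lemma dirderiv_lip V W (F : V -> W) x r C y h h' d d' :
  lip_on F x r C -> `|y - x| < r -> dirderiv F y h d -> dirderiv F y h' d' ->
  `|d - d'| <= C * `|h - h'|.
Proof.
move=> L yr Hd Hd'; apply/ler_addgt0Pr => e e0.
have e20 : 0 < e / 2 by lra.
have [s s0 Hs] := Hd _ e20; have [s' s'0 Hs'] := Hd' _ e20.
have [q q0 Hq] := ball_shrink yr.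
have [u u0 Hu] := line_near y h q0; have [u' u'0 Hu'] := line_near y h' q0.
pose m := Num.min (Num.min s s') (Num.min u u').
have m0 : 0 < m by rewrite !lt_min s0 s'0 u0.
pose t := m / 2; have t0 : 0 < t by rewrite /t; lra.
have : t < m by rewrite /t; lra.
rewrite !lt_min => /andP[/andP[ts ts'] /andP[tu tu']].
have := Hs t t0 ts; have := Hs' t t0 ts'.
have := L _ _ (Hq _ (Hu t t0 tu)) (Hq _ (Hu' t t0 tu')).
set A := F (y + t *: h); set B := F (y + t *: h').
have -> : y + t *: h - (y + t *: h') = t *: (h - h').
  by rewrite opprD addrACA subrr add0r scalerBr.
rewrite normrZ (gtr0_norm t0) => H1 H2 H3.
have : `|t *: (d - d')| <= (C * `|h - h'| + e) * t.
  rewrite scalerBr; apply: le_trans (ler_distD (A - F y) _ _) _.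
  rewrite distrC; apply: le_trans (lerD (lexx _) (ler_distD (B - F y) _ _)) _.
  have -> : A - F y - (B - F y) = A - B by rewrite opprB addrA subrK.
  lra.
by rewrite normrZ gtr0_norm// mulrC ler_pM2r.
Qed.

Lemma dirderiv_comp U V W (f : V -> W) (g : W -> U) r C y h d d' :
  0 < r -> 0 < C -> lip_on g (f y) r C ->
  dirderiv f y h d -> dirderiv g (f y) d d' -> dirderiv (g \o f) y h d'.
Proof.
move=> r0 C0 L Hf Hg e e0.
have eC : 0 < e / (2 * C) by rewrite divr_gt0//; lra.
have e2 : 0 < e / 2 by lra.
have [s s0 Hs] := Hf _ eC; have [q q0 Hq] := Hg _ e2.
have [u u0 Hu] := line_near (f y) d r0.
have k0 : 0 < e / (2 * C) + `|d| by rewrite ltr_pwDl.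
exists (Num.min (Num.min s q) (Num.min u (r / (e / (2 * C) + `|d|)))).
  by rewrite !lt_min s0 q0 u0 divr_gt0.
move=> t t0; rewrite !lt_min => /andP[/andP[ts tq] /andP[tu]].
rewrite ltr_pdivlMr// => tr /=.
have H1 := Hs t t0 ts; have H2 := Hq t t0 tq; have H3 := Hu t t0 tu.
have H4 : `|f (y + t *: h) - f y| < r.
  apply: le_lt_trans tr; rewrite -(subrK (t *: d) (_ - f y)).
  apply: le_trans (ler_normD _ _) _; rewrite normrZ gtr0_norm//; lra.
have -> : g (f (y + t *: h)) - g (f y) - t *: d' =
   (g (f (y + t *: h)) - g (f y + t *: d)) + (g (f y + t *: d) - g (f y) - t *: d').
  by zmod_ring.
apply: le_trans (ler_normD _ _) _.
have := L _ _ H4 H3; rewrite opprD addrA => H5.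
have H6 : C * `|f (y + t *: h) - f y - t *: d| <= C * (e / (2 * C) * t) by rewrite ler_pM2l.
have E : C * (e / (2 * C) * t) = e / 2 * t by field; lra.
lra.
Qed.

(** With d = f'(y; y - x), the error splits into the error of g along f y - f x and the difference
    of g' along f y - f x and along d. The first is quadratic by hypothesis on g; [dirderiv_lip]
    bounds the second by Cg |f y - f x - d|, quadratic by hypothesis on f. *)
Lemma semis_comp U V W (f : V -> W) (g : W -> U) x :
  semis f x -> semis g (f x) -> semis (g \o f) x.
Proof.
move=> [rf [Cf [rf0 Cf0 [Lf Sf]]]] [rg [Cg [rg0 Cg0 [Lg Sg]]]].
have near : forall y, `|y - x| < rf -> `|y - x| < rg / Cf -> `|f y - f x| < rg.
  move=> y yrf; rewrite ltr_pdivlMr// => yrg.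
  apply: le_lt_trans (Lf _ _ yrf _) _; last by rewrite mulrC.
  by rewrite subrr normr0.
exists (Num.min rf (rg / Cf)), (Cg * Cf + Cg * Cf + Cg * Cf ^+ 2); split.
- by rewrite lt_min rf0 divr_gt0.
- have := mulr_gt0 Cg0 Cf0; have := mulr_gt0 Cg0 (exprn_gt0 2 Cf0); lra.
split=> [y z|y].
  rewrite !lt_min => /andP[y1 y2] /andP[z1 z2] /=.
  apply: le_trans (Lg _ _ (near _ y1 y2) (near _ z1 z2)) _.
  have H := Lf _ _ y1 z1.
  have H1 : Cg * `|f y - f z| <= Cg * (Cf * `|y - z|) by rewrite ler_pM2l.
  apply: le_trans H1 _; rewrite mulrA ler_wpM2r//.
  have := mulr_gt0 Cg0 Cf0; have := mulr_gt0 Cg0 (exprn_gt0 2 Cf0); lra.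
rewrite !lt_min => /andP[y1 y2].
have y3 := near _ y1 y2.
have [s s0 Hs] := ball_shrink y3.
have Lgy : lip_on g (f y) s Cg by move=> a b /Hs a1 /Hs b1; exact: Lg.
have [Df [d Hd He]] := Sf _ y1; have [Dg [d0 Hd0 He0]] := Sg _ y3.
split=> [h|].
  have [k Hk] := Df h; have [k' Hk'] := Dg k.
  by exists k'; apply: dirderiv_comp Hk Hk'; [exact: s0|exact: Cg0|].
have [d' Hd'] := Dg d.
exists d'; first by apply: dirderiv_comp Hd Hd'; [exact: s0|exact: Cg0|].
have -> : (g \o f) y - (g \o f) x - d' = (g (f y) - g (f x) - d0) + (d0 - d').
  by rewrite /=; zmod_ring.
apply: le_trans (ler_normD _ _) _.
have H1 := dirderiv_lip Lg y3 Hd0 Hd'.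
have H2 : Cg * `|f y - f x - d| <= Cg * (Cf * `|y - x| ^+ 2) by rewrite ler_pM2l.
have H3 : Cg * `|f y - f x| ^+ 2 <= Cg * (Cf * `|y - x|) ^+ 2.
  rewrite ler_pM2l// ler_pXn2r ?nnegrE ?mulr_ge0 ?(ltW Cf0)//.
  by apply: Lf; rewrite ?subrr ?normr0.
have H4 := mulr_ge0 (mulr_ge0 (ltW Cg0) (ltW Cf0)) (exprn_ge0 2 (normr_ge0 (y - x))).
rewrite exprMn in H3; lra.
Qed.

Lemma semis_near V W (F G : V -> W) x r : 0 < r ->
  (forall y, `|y - x| < r -> F y = G y) -> semis G x -> semis F x.
Proof.
move=> r0 FG [s [C [s0 C0 [L S]]]].
exists (Num.min r s), C; split=> //; first by rewrite lt_min r0.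
have xx : `|x - x| < r by rewrite subrr normr0.
split=> [y z|y].
  by rewrite !lt_min => /andP[/FG -> y2] /andP[/FG -> z2]; exact: L.
rewrite lt_min => /andP[y1 y2].
have tr h d : dirderiv G y h d -> dirderiv F y h d.
  move=> H e /H[q q0 Hq].
  have [p p0 Hp] := ball_shrink y1; have [u u0 Hu] := line_near y h p0.
  exists (Num.min q u); first by rewrite lt_min q0.
  by move=> t t0; rewrite lt_min => /andP[tq /(Hu _ t0)/Hp/FG ->]; rewrite FG//; exact: Hq.
have [D [d Hd He]] := S y y2; split=> [h|]; last by exists d; [exact: tr|rewrite !FG].
by have [k Hk] := D h; exists k; exact: tr.
Qed.

Lemma semis_ext V W (F G : V -> W) x : F =1 G -> semis G x -> semis F x.
Proof. by move=> FG; apply: (@semis_near _ _ _ _ _ 1). Qed.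

Lemma dirderiv_pair U V W (f : V -> W) (g : V -> U) y h d d' :
  dirderiv f y h d -> dirderiv g y h d' ->
  dirderiv (fun z => (f z, g z)) y h (d, d').
Proof.
move=> Hf Hg e e0; have [r r0 Hr] := Hf e e0; have [s s0 Hs] := Hg e e0.
exists (Num.min r s); first by rewrite lt_min r0.
move=> t t0; rewrite lt_min => /andP[tr ts]; rewrite prod_normE ge_max /=.
by rewrite Hr// Hs.
Qed.

Lemma semis_pair U V W (f : V -> W) (g : V -> U) x :
  semis f x -> semis g x -> semis (fun z => (f z, g z)) x.
Proof.
move=> [rf [Cf [rf0 Cf0 If]]] [rg [Cg [rg0 Cg0 Ig]]].
exists (Num.min rf rg), (Num.max Cf Cg); split; rewrite ?lt_min ?lt_max ?rf0 ?rg0 ?Cf0//.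
have {If} [Lf Sf] : semis_in f x (Num.min rf rg) (Num.max Cf Cg).
  by apply: semis_inW If; rewrite ?ge_min ?le_max lexx ?orbT.
have {Ig} [Lg Sg] : semis_in g x (Num.min rf rg) (Num.max Cf Cg).
  by apply: semis_inW Ig; rewrite ?ge_min ?le_max lexx ?orbT.
split=> [y z yr zr|y yr].
  by rewrite prod_normE ge_max /= Lf// Lg.
have [Df [d Hd He]] := Sf _ yr; have [Dg [d' Hd' He']] := Sg _ yr.
split=> [h|].
  by have [k Hk] := Df h; have [l Hl] := Dg h; exists (k, l); exact: dirderiv_pair.
exists (d, d'); first exact: dirderiv_pair.
by rewrite prod_normE ge_max /= He.
Qed.

(** The estimate expands F at y and evaluates the expansion at x, so homogeneity of [D y] is used
    with t = -1 to turn x - y into y - x. *)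
Lemma semis_C11 V W (F : V -> W) (D : V -> V -> W) x r C :
  0 < r -> 0 < C -> (forall y t h, D y (t *: h) = t *: D y h) ->
  (forall y h, `|y - x| < r -> `|D y h| <= C * `|h|) ->
  (forall y z, `|y - x| < r -> `|z - x| < r ->
     `|F z - F y - D y (z - y)| <= C * `|z - y| ^+ 2) ->
  semis F x.
Proof.
move=> r0 C0 DZ DC FC.
exists r, (C * (2 * r) + C); split=> //.
  by have := mulr_gt0 C0 r0; lra.
have CC : C <= C * (2 * r) + C by have := mulr_gt0 C0 r0; lra.
split=> [y z yr zr|y yr].
  have H1 := FC _ _ zr yr; have H2 := DC z (y - z) zr.
  have := le_trans (ler_normD _ _) (lerD H1 H2); rewrite subrK => H3.
  apply: le_trans H3 _.
  have H4 : `|y - z| <= 2 * r.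
    by have := ler_distD x y z; rewrite (distrC x z); lra.
  have := ler_wpM2l (ltW C0) (ler_wpM2r (normr_ge0 (y - z)) H4); rewrite -expr2; lra.
have Dy h : dirderiv F y h (D y h).
  move=> e e0; have [s s0 Hs] := ball_shrink yr.
  have [u u0 Hu] := line_near y h s0.
  have k0 : 0 < C * `|h| ^+ 2 + 1.
    by have := mulr_ge0 (ltW C0) (exprn_ge0 2 (normr_ge0 h)); lra.
  exists (Num.min u (e / (C * `|h| ^+ 2 + 1))); first by rewrite lt_min u0 divr_gt0.
  move=> t t0; rewrite lt_min ltr_pdivlMr// => /andP[tu te].
  have := FC _ _ yr (Hs _ (Hu _ t0 tu)).
  rewrite [y + _ - _]addrC addKr DZ normrZ (gtr0_norm t0) => H; apply: le_trans H _.
  have -> : C * (t * `|h|) ^+ 2 = (t * (C * `|h| ^+ 2)) * t by ring.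
  by rewrite ler_pM2r//; lra.
split=> [h|]; first by exists (D y h).
exists (D y (y - x)) => //.
have xr : `|x - x| < r by rewrite subrr normr0.
have := FC _ _ yr xr.
have -> : x - y = (-1) *: (y - x) by rewrite scaleN1r opprB.
rewrite DZ scaleN1r normrZ normrN1 mul1r opprK => H.
have -> : F y - F x - D y (y - x) = - (F x - F y + D y (y - x)) by zmod_ring.
rewrite normrN; apply: le_trans H _.
by rewrite ler_wpM2r// exprn_ge0.
Qed.

Lemma semis_cst V W (w : W) (x : V) : semis (fun=> w) x.
Proof.
apply: (@semis_C11 _ _ _ (fun _ _ => 0) x 1 1) => // [y t h|y h _|y z _ _].
- by rewrite scaler0.
- by rewrite normr0 mul1r.
- by rewrite !subrr normr0 mul1r exprn_ge0.
Qed.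

Lemma semis_linear V W (f : {linear V -> W}) C x :
  (forall h, `|f h| <= C * `|h|) -> semis f x.
Proof.
move=> fC; have C0 : 0 < Num.max C 1 by rewrite lt_max ltr01 orbT.
apply: (@semis_C11 _ _ _ (fun _ => f) x 1 (Num.max C 1)) => // [y t h|y h _|y z _ _].
- by rewrite linearZ.
- by apply: le_trans (fC h) _; rewrite ler_wpM2r// le_max lexx.
- by rewrite linearB subrr normr0 mulr_ge0 ?exprn_ge0// ltW.
Qed.

Lemma semis_id V (x : V) : semis (fun y => y) x.
Proof. by apply: (@semis_linear _ _ idfun 1) => h; rewrite mul1r. Qed.

Lemma semis_fst V W (x : V * W) : semis fst x.
Proof.
by apply: (@semis_linear _ _ fst 1) => h; rewrite mul1r prod_normE le_max lexx.
Qed.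

Lemma semis_snd V W (x : V * W) : semis snd x.
Proof.
by apply: (@semis_linear _ _ snd 1) => h; rewrite mul1r prod_normE le_max lexx orbT.
Qed.

Lemma semisD V W (f g : V -> W) x :
  semis f x -> semis g x -> semis (fun y => f y + g y) x.
Proof.
move=> Sf Sg; apply: (semis_comp (semis_pair Sf Sg) (g := fun p : W * W => p.1 + p.2)).
apply: (@semis_C11 _ _ _ (fun _ p => p.1 + p.2) _ 1 2) => // [_ t h|y h _|y z _ _].
- by rewrite scalerDr.
- apply: le_trans (ler_normD _ _) _.
  have : `|h.1| <= `|h| by rewrite prod_normE le_max lexx.
  have : `|h.2| <= `|h| by rewrite prod_normE le_max lexx orbT.
  lra.
- have -> : z.1 + z.2 - (y.1 + y.2) - ((z - y).1 + (z - y).2) = 0 by zmod_ring.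
  by rewrite normr0 mulr_ge0// exprn_ge0.
Qed.

Lemma semisZ V W (a : V -> R^o) (f : V -> W) x :
  semis a x -> semis f x -> semis (fun y => a y *: f y) x.
Proof.
move=> Sa Sf; have Sp := semis_pair Sa Sf.
apply: (semis_comp Sp (g := fun p : R^o * W => p.1 *: p.2)).
set p0 := (a x, f x).
have n1 (h : R^o * W) : `|h.1| <= `|h| by rewrite prod_normE le_max lexx.
have n2 (h : R^o * W) : `|h.2| <= `|h| by rewrite prod_normE le_max lexx orbT.
have C0 : 0 < 2 * `|p0| + 2 by have := normr_ge0 p0; lra.
apply: (@semis_C11 _ _ _ (fun p h : R^o * W => h.1 *: p.2 + p.1 *: h.2) p0 1 _ _ C0) => //.
- by move=> y t h; rewrite /= scalerDr !scalerA; congr (_ + _ *: _); rewrite mulrC.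
- move=> y h yr; apply: le_trans (ler_normD _ _) _; rewrite !normrZ.
  have yp : `|y| <= `|p0| + 1.
    rewrite -(subrK p0 y); apply: le_trans (ler_normD _ _) _; lra.
  have A1 := ler_pM (normr_ge0 _) (normr_ge0 _) (n1 h) (le_trans (n2 y) yp).
  have A2 := ler_pM (normr_ge0 _) (normr_ge0 _) (le_trans (n1 y) yp) (n2 h).
  lra.
- move=> y z _ _.
  have -> : z.1 *: z.2 - y.1 *: y.2 - ((z - y).1 *: y.2 + y.1 *: (z - y).2) =
     (z - y).1 *: (z - y).2.
    by rewrite /= !scalerBl !scalerBr; zmod_ring.
  rewrite normrZ; apply: le_trans (ler_pM (normr_ge0 _) (normr_ge0 _) (n1 _) (n2 _)) _.
  by rewrite -expr2 -[leLHS]mul1r ler_wpM2r ?exprn_ge0//; have := normr_ge0 p0; lra.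
Qed.

Lemma semis_sum V W (I : Type) (s : seq I) (f : I -> V -> W) x :
  (forall i, semis (f i) x) -> semis (fun y => \sum_(i <- s) f i y) x.
Proof.
move=> Sf; elim: s => [|i s IH].
  by apply: semis_ext (semis_cst 0 x) => y; rewrite big_nil.
by apply: semis_ext (semisD (Sf i) IH) => y; rewrite big_cons.
Qed.

End Semismooth.

(** * Real functions: inverse, square root, exponential, positive part *)

Section ScalarFunctions.
Context {R : realType}.
Implicit Types V W : normedModType R.

Lemma semisM V (f g : V -> R^o) x :
  semis f x -> semis g x -> semis (fun y => f y * g y : R^o) x.
Proof. exact: semisZ. Qed.

Lemma semisN V (f : V -> R^o) x : semis f x -> semis (fun y => - f y : R^o) x.
Proof.
move=> Sf; apply: semis_ext (semisM (semis_cst (-1 : R^o) x) Sf) => y.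
by rewrite mulN1r.
Qed.

Lemma semisB V (f g : V -> R^o) x :
  semis f x -> semis g x -> semis (fun y => f y - g y : R^o) x.
Proof. by move=> Sf /semisN; exact: semisD. Qed.

Lemma semisX V (f : V -> R^o) x n : semis f x -> semis (fun y => f y ^+ n : R^o) x.
Proof.
move=> Sf; elim: n => [|n IH]; first exact: semis_cst.
by apply: semis_ext (semisM Sf IH) => y; rewrite exprS.
Qed.

Lemma semis_diff (phi phi' : R -> R) (x r C : R) : 0 < r -> 0 < C ->
  (forall y, `|y - x| < r -> `|phi' y| <= C) ->
  (forall y z, `|y - x| < r -> `|z - x| < r ->
     `|phi z - phi y - phi' y * (z - y)| <= C * `|z - y| ^+ 2) ->
  semis (phi : R^o -> R^o) x.
Proof.
move=> r0 C0 HC H.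
apply: (@semis_C11 _ _ _ _ (fun y h : R^o => phi' y * h : R^o) x r C) => //.
- by move=> y t h; rewrite /GRing.scale /= mulrCA.
- by move=> y h yr; rewrite normrM ler_wpM2r// HC.
Qed.

Lemma semis_inv (x : R) : x != 0 -> semis (fun y : R^o => y^-1 : R^o) x.
Proof.
move=> x0; pose k := `|x| / 2.
have k0 : 0 < k by rewrite divr_gt0// normr_gt0.
have far (y : R) : `|y - x| < k -> k <= `|y|.
  by have := ler_distD y x 0; rewrite !subr0 (distrC x y) /k; lra.
have nz (y : R) : k <= `|y| -> y != 0.
  by move=> ky; rewrite -normr_gt0; apply: lt_le_trans ky.
apply: (@semis_diff _ (fun y => - (y ^+ 2)^-1) x k (k^-1 ^+ 2 + k^-1 ^+ 3)) => //.
- by rewrite addr_gt0// exprn_gt0// invr_gt0.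
- move=> y /far ky; rewrite normrN normrV ?unitfE ?expf_neq0 ?nz// normrX -exprVn.
  have : `|y|^-1 ^+ 2 <= k^-1 ^+ 2.
    by rewrite ler_pXn2r ?nnegrE ?invr_ge0 ?(ltW k0)// lef_pV2// posrE ?(lt_le_trans k0).
  have : 0 < k^-1 ^+ 3 by rewrite exprn_gt0// invr_gt0.
  lra.
- move=> y z /far ky /far kz; have y0 := nz _ ky; have z0 := nz _ kz.
  have -> : z^-1 - y^-1 - - (y ^+ 2)^-1 * (z - y) = y^-1 ^+ 2 * z^-1 * (z - y) ^+ 2.
    by field; rewrite y0 z0.
  rewrite normrM normrX ler_wpM2r ?exprn_ge0// normrM normrX !normfV.
  have iy : `|y|^-1 <= k^-1 by rewrite lef_pV2// posrE ?(lt_le_trans k0).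
  have iz : `|z|^-1 <= k^-1 by rewrite lef_pV2// posrE ?(lt_le_trans k0).
  have H : `|y|^-1 ^+ 2 * `|z|^-1 <= k^-1 ^+ 2 * k^-1.
    by rewrite ler_pM ?exprn_ge0 ?invr_ge0// ler_pXn2r ?nnegrE ?invr_ge0 ?(ltW k0).
  apply: le_trans H _; rewrite -exprSr.
  have : 0 < k^-1 ^+ 2 by rewrite exprn_gt0// invr_gt0.
  lra.
Qed.

Lemma semis_sqrt (x : R) : 0 < x -> semis (fun y : R^o => Num.sqrt y : R^o) x.
Proof.
move=> x0; pose k := x / 2; have k0 : 0 < k by rewrite divr_gt0.
have far (y : R) : `|y - x| < k -> k <= y.
  by rewrite ltr_distl /k => /andP[]; lra.
pose s := Num.sqrt k; have s0 : 0 < s by rewrite sqrtr_gt0.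
have sq (y : R) : k <= y -> s <= Num.sqrt y by move=> ?; rewrite ler_wsqrtr.
have i0 : 0 < s^-1 by rewrite invr_gt0.
apply: (@semis_diff _ (fun y => (2 * Num.sqrt y)^-1) x k (s^-1 + s^-1 ^+ 3)) => //.
- by rewrite addr_gt0// exprn_gt0.
- move=> y /far/sq sy; rewrite ger0_norm ?invr_ge0 ?mulr_ge0 ?sqrtr_ge0//.
  have : (2 * Num.sqrt y)^-1 <= s^-1 by rewrite lef_pV2 ?posrE//; lra.
  have : 0 < s^-1 ^+ 3 by rewrite exprn_gt0.
  lra.
- move=> y z /far ky /far kz; have y0 := sq _ ky; have z0 := sq _ kz.
  have ey : y = Num.sqrt y ^+ 2 by rewrite sqr_sqrtr//; lra.
  have ez : z = Num.sqrt z ^+ 2 by rewrite sqr_sqrtr//; lra.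
  (* With y = a^2 and z = b^2 the Taylor remainder is exactly -(b - a)^2 / (2 a), while |z - y| = |b
     - a| (a + b) and a + b >= s. *)
  have -> : z - y = Num.sqrt z ^+ 2 - Num.sqrt y ^+ 2 by rewrite -ez -ey.
  move: (Num.sqrt y) (Num.sqrt z) y0 z0 => a b sa sb.
  have a0 : 0 < a by lra.
  have ab : 0 < a + b by lra.
  have -> : b - a - (2 * a)^-1 * (b ^+ 2 - a ^+ 2) = - ((2 * a)^-1 * (b - a) ^+ 2).
    by field; lra.
  rewrite normrN subr_sqr (normrM (b - a)) (normrM _ (_ ^+ 2)) normrX.
  rewrite (gtr0_norm (_ : 0 < (2 * a)^-1)); last by rewrite invr_gt0; lra.
  rewrite exprMn [leRHS]mulrCA [leLHS]mulrC ler_wpM2l ?exprn_ge0//.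
  have H1 : (2 * a)^-1 <= s^-1 by rewrite lef_pV2 ?posrE//; lra.
  have H2 : s ^+ 2 <= `|b + a| ^+ 2.
    by rewrite real_normK ?num_real// ler_pXn2r ?nnegrE//; lra.
  have H3 : s^-1 = s^-1 ^+ 3 * s ^+ 2 by field; lra.
  have H4 : s^-1 ^+ 3 * s ^+ 2 <= s^-1 ^+ 3 * `|b + a| ^+ 2.
    by rewrite ler_wpM2l ?exprn_ge0 ?(ltW i0).
  have H5 : 0 <= s^-1 * `|b + a| ^+ 2 by rewrite mulr_ge0 ?exprn_ge0 ?(ltW i0).
  by rewrite [leRHS]mulrDl; apply: le_trans H1 _; rewrite {1}H3; apply: le_trans H4 _; rewrite lerDr.
Qed.

(** From 1 + u <= e^u and e^u (1 - u) <= 1, the difference lies between 0 and u^2 / (1 - u). *)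
Lemma expR_quad (u : R) : `|u| <= 1 / 2 -> `|expR u - 1 - u| <= 2 * `|u| ^+ 2.
Proof.
rewrite ler_norml real_normK ?num_real// => /andP[u1 u2].
have H1 := expR_ge1Dx u; have H2 := expR_ge1Dx (- u).
have e0 := expR_gt0 u.
have H3 : expR u * (1 - u) <= 1 by rewrite -[leRHS](expRxMexpNx_1 u) ler_pM2l.
rewrite ger0_norm; last by lra.
rewrite -(ler_pM2r (_ : 0 < 1 - u)); last by lra.
nra.
Qed.

Lemma semis_exp (x : R) : semis (fun y : R^o => expR y : R^o) x.
Proof.
have e0 := expR_gt0 (x + 1).
apply: (@semis_diff _ (fun y => expR y) x (1 / 4) (2 * expR (x + 1))); try lra.
  move=> y; rewrite ltr_distl => /andP[_ yx]; rewrite ger0_norm ?expR_ge0//.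
  have : expR y <= expR (x + 1) by rewrite ler_expR; lra.
  lra.
move=> y z yx zx.
have -> : expR z - expR y - expR y * (z - y) = expR y * (expR (z - y) - 1 - (z - y)).
  by rewrite expRB; field; rewrite gt_eqF// expR_gt0.
have : `|z - y| <= 1 / 2 by have := ler_distD x z y; rewrite (distrC x y); lra.
move/expR_quad => H; rewrite normrM ger0_norm ?expR_ge0// (mulrC 2) -mulrA.
apply: ler_pM => //; rewrite ?expR_ge0//.
by rewrite ler_expR; move: yx; rewrite ltr_distl => /andP[_]; lra.
Qed.

Definition pospart (y : R) : R := Num.max y 0.

Lemma pospart_ge0 y : 0 <= pospart y.
Proof. by rewrite le_max lexx orbT. Qed.

Lemma ger0_pospart y : 0 <= y -> pospart y = y.
Proof. exact: max_idPl. Qed.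

Lemma ler0_pospart y : y <= 0 -> pospart y = 0.
Proof. exact: max_idPr. Qed.

Lemma pospart_homo x y : x <= y -> pospart x <= pospart y.
Proof. by move=> xy; rewrite ge_max !le_max xy lexx orbT. Qed.

Lemma pospartM t y : 0 <= t -> pospart (t * y) = t * pospart y.
Proof. by move=> t0; rewrite /pospart maxr_pMr// mulr0. Qed.

Lemma pospart_lip y z : `|pospart y - pospart z| <= `|y - z|.
Proof.
wlog yz : y z / z <= y.
  by move=> W; have [/W//|/ltW/W] := leP z y; rewrite distrC (distrC y).
rewrite (ger0_norm (_ : 0 <= y - z)) ?subr_ge0//.
rewrite ger0_norm ?subr_ge0 ?pospart_homo// /pospart.
by case: (leP y 0); case: (leP z 0); lra.
Qed.

(** The quadratic error is zero: at the kink x = 0 the derivative at y along y is [pospart y]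
    itself, and for x <> 0 the function is linear on the ball of radius |x|. *)
Lemma semis_pospart (x : R) : semis (pospart : R^o -> R^o) x.
Proof.
pose D (y h : R) : R := if 0 < y then h else if y < 0 then 0 else pospart h.
have Dd (y h : R) : dirderiv (pospart : R^o -> R^o) y h (D y h).
  move=> e e0; rewrite /D; case: (ltgtP 0 y) => y0.
  - have [r r0 Hr] := @line_near _ R^o y h _ y0; exists r => // t t0 /(Hr _ t0).
    rewrite ltr_distl => /andP[H _].
    rewrite (ger0_pospart (ltW y0)) ger0_pospart; last by lra.
    by rewrite [y + _]addrC addrK subrr normr0 mulr_ge0 ?ltW.
  - have Ny0 : 0 < - y by lra.
    have [r r0 Hr] := @line_near _ R^o y h _ Ny0; exists r => // t t0 /(Hr _ t0).
    rewrite ltr_distl => /andP[_ H].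
    rewrite (ler0_pospart (ltW y0)) ler0_pospart; last by lra.
    by rewrite scaler0 !subrr normr0 mulr_ge0 ?ltW.
  - exists 1 => // t t0 _; rewrite -y0 add0r (ger0_pospart (lexx _)) subr0.
    by rewrite pospartM ?(ltW t0)// subrr normr0 mulr_ge0 ?ltW.
exists (if x == 0 then 1 else `|x|), 1; split=> //.
  by case: eqVneq => // x0; rewrite normr_gt0.
split=> [y z _ _|y yr]; first by rewrite mul1r; exact: pospart_lip.
split=> [h|]; first by exists (D y h).
exists (D y (y - x)) => //; rewrite (_ : _ - D _ _ = 0) ?normr0 ?mulr_ge0 ?exprn_ge0//.
move: (y : R) yr => {}y; rewrite /D; case: eqVneq => [->|x0] yr.
  rewrite subr0 (ger0_pospart (lexx 0)) subr0; case: (ltgtP 0 y) => y0.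
  - by rewrite ger0_pospart ?ltW// subrr.
  - by rewrite ler0_pospart ?ltW// subrr.
  - by rewrite subrr.
move: yr; rewrite ltr_distl; have [x1|x1|x1] := ltgtP 0 x; last by rewrite x1 eqxx in x0.
- rewrite gtr0_norm// => /andP[y1 _].
  have y0 : 0 < y by lra.
  by rewrite y0 !ger0_pospart ?ltW// subrr.
- rewrite ltr0_norm// => /andP[_ y1].
  have yn : y < 0 by lra.
  by rewrite ltNge (ltW yn) yn /= !ler0_pospart ?ltW// !subrr.
Qed.

End ScalarFunctions.

(** * Zeros of strongly increasing functions *)

Section Implicit.
Context {R : realType}.
Implicit Types V W : normedModType R.

(** The zero is the supremum of the points with f <= 0: strong monotonicity bounds this set by |f 0|
    / m, and the local Lipschitz bound excludes a nonzero value at the supremum. It serves for the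
    yield equation and for the directional equation of the implicit function. *)
Lemma strongly_monotone_root (f : R -> R) (m : R) : 0 < m ->
  (forall p q, p <= q -> m * (q - p) <= f q - f p) ->
  (forall p, exists r C, [/\ 0 < r, 0 < C &
     forall q, `|q - p| < r -> `|f q - f p| <= C * `|q - p|]) ->
  exists p, f p = 0.
Proof.
move=> m0 mono cont.
pose E : set R := [set p | f p <= 0]%classic.
have E0 : E (- (`|f 0| / m)).
  have k0 : 0 <= `|f 0| / m by rewrite divr_ge0// ltW.
  have := mono (- (`|f 0| / m)) 0; rewrite oppr_le0 => /(_ k0).
  rewrite sub0r opprK mulrC divfK ?gt_eqF//; have := ler_norm (f 0); rewrite /E /=; lra.
have ub p : E p -> p <= `|f 0| / m.
  move=> Ep; have [p0|/ltW p0] := leP p 0.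
    by apply: le_trans p0 _; rewrite divr_ge0// ltW.
  have := mono _ _ p0; rewrite subr0 ler_pdivlMr// mulrC.
  have := ler_norm (- f 0); rewrite normrN; move: Ep; rewrite /E /=; lra.
have hE : has_sup E by split; [exists (- (`|f 0| / m))|exists (`|f 0| / m)].
exists (sup E); set s := sup E.
have [r [C [r0 C0 H]]] := cont s.
have [fs|fs|//] := ltgtP (f s) 0; exfalso.
- pose d := Num.min r (- f s / C) / 2.
  have n0 : 0 < Num.min r (- f s / C) by rewrite lt_min r0 divr_gt0//; lra.
  have d0 : 0 < d by rewrite /d; lra.
  have : d < Num.min r (- f s / C) by rewrite /d; lra.
  rewrite lt_min ltr_pdivlMr// => /andP[dr dC].
  have ds : `|s + d - s| = d by rewrite addrC addKr gtr0_norm.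
  have := H (s + d); rewrite ds => /(_ dr); rewrite ler_norml => /andP[_ H1].
  have Es : E (s + d) by rewrite /E /=; lra.
  by have := sup_upper_bound hE Es; rewrite -/s; lra.
- pose d := Num.min r (f s / C) / 2.
  have n0 : 0 < Num.min r (f s / C) by rewrite lt_min r0 divr_gt0//; lra.
  have d0 : 0 < d by rewrite /d; lra.
  have : d < Num.min r (f s / C) by rewrite /d; lra.
  rewrite lt_min ltr_pdivlMr// => /andP[dr dC].
  have ds : `|s - d - s| = d by rewrite addrC addKr normrN gtr0_norm.
  have := H (s - d); rewrite ds => /(_ dr); rewrite ler_norml => /andP[H1 _].
  have [q Eq sq] := sup_adherent d0 hE.
  have := mono _ _ (ltW sq); have := mulr_gt0 m0 (_ : 0 < q - (s - d)).
  by move: Eq; rewrite /E /= -/s in sq *; lra.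
Qed.

End Implicit.

(** * Implicit functions *)

Section ImplicitFunction.
Context {R : realType} (V : normedModType R).
Variables (F : R^o * V -> R^o) (m : R).
Hypothesis m0 : 0 < m.
Hypothesis mono : forall v (a b : R), a <= b -> m * (b - a) <= F (b, v) - F (a, v).

Lemma strongly_monotone_dist v (a b : R) : m * `|a - b| <= `|F (a, v) - F (b, v)|.
Proof.
wlog ab : a b / a <= b.
  by move=> W; have [/W//|/ltW/W] := leP a b; rewrite distrC (distrC (F _)).
rewrite distrC (distrC (F _)) (ger0_norm (_ : 0 <= b - a)) ?subr_ge0//.
exact: le_trans (mono v ab) (ler_norm _).
Qed.

Lemma dirderiv_strongly_monotone y (p a b : R) h da db : a <= b ->
  dirderiv F (p, y) (a : R^o, h) da -> dirderiv F (p, y) (b : R^o, h) db ->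
  m * (b - a) <= db - da.
Proof.
move=> ab Ha Hb; apply/ler_addgt0Pr => e e0.
have e20 : 0 < e / 2 by lra.
have [r r0 Hr] := Ha _ e20; have [s s0 Hs] := Hb _ e20.
pose t := Num.min r s / 2.
have k0 : 0 < Num.min r s by rewrite lt_min r0.
have t0 : 0 < t by rewrite /t; lra.
have : t < Num.min r s by rewrite /t; lra.
rewrite lt_min => /andP[/(Hr t t0) H1 /(Hs t t0)].
move: H1; rewrite !ler_norml => /andP[H1 _] /andP[_ H2].
have tab : p + t * a <= p + t * b by rewrite lerD2l ler_pM2l.
have H3 : m * (p + t * b - (p + t * a)) <=
    F ((p : R^o, y) + t *: (b : R^o, h)) - F ((p : R^o, y) + t *: (a : R^o, h)).
  exact: mono.
move: H1 H2 H3; set A := F ((p, y) + _); set B := F ((p, y) + _); set A0 := F (p, y).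
move: A B A0 => A B A0; rewrite /GRing.scale /= => H1 H2 H3; rewrite -(ler_pM2l t0); lra.
Qed.

(** The derivative of p along h is the root a of F'((p y, y); (a, h)), which inherits strong
    monotonicity in a. For the quadratic estimate, F vanishes along the graph, so the hypothesis on
    F bounds F'((p y, y); (p y - p x, y - x)); dividing by m bounds the distance of p y - p x to the
    root a. *)
Lemma semis_implicit (p : V -> R^o) x :
  (forall v, F (p v, v) = 0) -> semis F (p x, x) -> semis p x.
Proof.
move=> Fp [r [C [r0 C0 [L S]]]].
have nR (a b : R) (u w : V) : `|(a : R^o, u) - (b : R^o, w)| = Num.max `|a - b| `|u - w|.
  by rewrite prod_normE.
have K0 : 0 < C / m by rewrite divr_gt0.
(* Both points at which the Lipschitz bound of F is used have first coordinate [p x], so they lie in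
   the ball before any continuity of p is known. *)
have px y : `|y - x| < r -> `|p y - p x| <= C / m * `|y - x|.
  move=> yr; have := strongly_monotone_dist y (p y) (p x).
  rewrite Fp -(Fp x) => H; rewrite mulrAC ler_pdivlMr// mulrC; apply: le_trans H _.
  rewrite distrC; apply: le_trans (L _ _ _ _) _; rewrite ?nR ?subrr ?normr0 ?gt_max ?r0//.
  by rewrite (max_idPr _).
pose r' := Num.min r (r / (C / m)).
have r'0 : 0 < r' by rewrite lt_min r0 divr_gt0.
have near y z : `|y - x| < r' -> `|z - x| < r' ->
    `|(p y, z) - (p x, x)| < r.
  rewrite !lt_min nR gt_max => /andP[y1 y2] /andP[z1 _]; rewrite z1 andbT.
  by apply: le_lt_trans (px _ y1) _; rewrite mulrC -ltr_pdivlMr.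
have pyz y z : `|y - x| < r' -> `|z - x| < r' -> `|p y - p z| <= C / m * `|y - z|.
  move=> yr zr; have := strongly_monotone_dist z (p y) (p z).
  rewrite Fp -(Fp y) => H; rewrite mulrAC ler_pdivlMr// mulrC; apply: le_trans H _.
  rewrite distrC; apply: le_trans (L _ _ (near _ _ yr yr) (near _ _ yr zr)) _.
  by rewrite nR subrr normr0 (max_idPr _).
have D y h : `|y - x| < r' -> exists g : R -> R,
    (forall a, dirderiv F (p y, y) (a : R^o, h) (g a)) /\
    exists2 a, g a = 0 & dirderiv p y h a.
  move=> yr; have [Dy _] := S _ (near _ _ yr yr).
  have [g Hg] := choice (fun a : R => Dy (a : R^o, h)).
  exists g; split=> //.
  have [a ga] : exists a, g a = 0.
    apply: (@strongly_monotone_root _ _ m) => // [a b ab|a].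
      exact: dirderiv_strongly_monotone ab (Hg a) (Hg b).
    exists 1, C; split=> // b _.
    have := dirderiv_lip L (near _ _ yr yr) (Hg b) (Hg a).
    by rewrite nR subrr normr0 (max_idPl _).
  exists a => // e e0; have me : 0 < m * e by rewrite mulr_gt0.
  have [q q0 Hq] := Hg a _ me; exists q => // t t0 tq.
  rewrite -(ler_pM2l m0) -addrA -opprD.
  apply: le_trans (strongly_monotone_dist (y + t *: h) _ _) _.
  have := Hq t t0 tq; rewrite ga scaler0 subr0 !Fp sub0r normrN subr0 mulrA.
  exact.
exists r', (C / m + C * (C / m + 1) ^+ 2 / m); split=> //.
  by rewrite addr_gt0// divr_gt0// mulr_gt0// exprn_gt0// addr_gt0.
have K1 : 0 < C * (C / m + 1) ^+ 2 / m by rewrite divr_gt0// mulr_gt0// exprn_gt0// addr_gt0.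
split=> [y z yr zr|y yr].
  by apply: le_trans (pyz _ _ yr zr) _; rewrite ler_wpM2r//; lra.
split=> [h|]; first by have [g [_ [a _ Ha]]] := D y h yr; exists a.
have [g [Hg [a ga Ha]]] := D y (y - x) yr.
exists a => //.
have [_ [d Hd]] := S _ (near _ _ yr yr).
have -> : d = g (p y - p x) by apply: dirderiv_uniq Hd (Hg _).
rewrite !Fp subrr sub0r normrN nR => He.
have : m * `|p y - p x - a| <= C * (C / m + 1) ^+ 2 * `|y - x| ^+ 2.
  apply: (@le_trans _ _ `|g (p y - p x)|).
    have [ab|/ltW ab] := leP (p y - p x) a.
      have := dirderiv_strongly_monotone ab (Hg _) (Hg _).
      rewrite ga sub0r distrC ger0_norm ?subr_ge0// => H.
      by apply: le_trans H _; rewrite -normrN ler_norm.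
    have := dirderiv_strongly_monotone ab (Hg _) (Hg _).
    rewrite ga subr0 ger0_norm ?subr_ge0// => H.
    by apply: le_trans H _; rewrite ler_norm.
  have n0 := normr_ge0 (y - x); have nK := mulr_ge0 (ltW K0) n0.
  have Q : Num.max `|p y - p x| `|y - x| <= (C / m + 1) * `|y - x|.
    rewrite ge_max mulrDl mul1r; apply/andP; split; last by lra.
    by apply: le_trans (pyz _ _ yr _) _; rewrite ?subrr ?normr0//; lra.
  have Q0 : 0 <= Num.max `|p y - p x| `|y - x| by rewrite le_max normr_ge0.
  apply: le_trans He _; rewrite -mulrA -exprMn ler_pM2l// ler_pXn2r// nnegrE.
  exact: le_trans Q0 Q.
rewrite mulrC -ler_pdivlMr// => H; apply: le_trans H _.
rewrite mulrAC mulrDl lerDr mulr_ge0 ?exprn_ge0 ?(ltW K0)//.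
Qed.

End ImplicitFunction.

(** * From directional estimates to strong semismoothness *)

Section Frobenius.
Context {R : realType}.
Implicit Types A B C : 'M[R]_3.

Lemma fdotC A B : fdot A B = fdot B A.
Proof. by apply: eq_bigr => i _; apply: eq_bigr => j _; rewrite mulrC. Qed.

Lemma fdotDl A B C : fdot (A + B) C = fdot A C + fdot B C.
Proof.
rewrite -big_split; apply: eq_bigr => i _; rewrite -big_split.
by apply: eq_bigr => j _; rewrite mxE mulrDl.
Qed.

Lemma fdotZl a A B : fdot (a *: A) B = a * fdot A B.
Proof.
rewrite mulr_sumr; apply: eq_bigr => i _; rewrite mulr_sumr.
by apply: eq_bigr => j _; rewrite mxE mulrA.
Qed.

Lemma fdotDr A B C : fdot C (A + B) = fdot C A + fdot C B.
Proof. by rewrite !(fdotC C) fdotDl. Qed.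

Lemma fdotZr a A B : fdot A (a *: B) = a * fdot A B.
Proof. by rewrite !(fdotC A) fdotZl. Qed.

Lemma fdotNl A B : fdot (- A) B = - fdot A B.
Proof. by rewrite -scaleN1r fdotZl mulN1r. Qed.

Lemma fdotNr A B : fdot A (- B) = - fdot A B.
Proof. by rewrite fdotC fdotNl fdotC. Qed.

Definition fdotE := (fdotDl, fdotDr, fdotZl, fdotZr, fdotNl, fdotNr).

Lemma fdot_sqr_ge0 A : 0 <= fdot A A.
Proof. by apply: sumr_ge0 => i _; apply: sumr_ge0 => j _; rewrite -expr2 sqr_ge0. Qed.

Lemma fnorm_ge0 A : 0 <= fnorm A.
Proof. exact: sqrtr_ge0. Qed.

Lemma sqr_fnorm A : fnorm A ^+ 2 = fdot A A.
Proof. by rewrite sqr_sqrtr ?fdot_sqr_ge0. Qed.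

Lemma normr_coord_fnorm A i j : `|A i j| <= fnorm A.
Proof.
rewrite -ler_sqr ?nnegrE ?fnorm_ge0// sqr_fnorm real_normK ?num_real//.
rewrite /fdot (bigD1 i)//= (bigD1 j)//= -expr2 -addrA lerDl addr_ge0//.
  by apply: sumr_ge0 => k _; rewrite -expr2 sqr_ge0.
by apply: sumr_ge0 => k _; apply: sumr_ge0 => l _; rewrite -expr2 sqr_ge0.
Qed.

Lemma fnorm_eq0 A : fnorm A = 0 -> A = 0.
Proof.
move=> A0; apply/matrixP => i j; rewrite mxE; apply/eqP; rewrite -normr_le0 -A0.
exact: normr_coord_fnorm.
Qed.

Lemma fnormZ a A : fnorm (a *: A) = `|a| * fnorm A.
Proof. by rewrite /fnorm fdotZl fdotZr mulrA -expr2 sqrtrM ?sqr_ge0// sqrtr_sqr. Qed.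

Lemma fnormN A : fnorm (- A) = fnorm A.
Proof. by rewrite -scaleN1r fnormZ normrN1 mul1r. Qed.

Lemma fdot_le A B : fdot A B <= fnorm A * fnorm B.
Proof.
have [A0|A0] := eqVneq (fnorm A) 0.
  by rewrite A0 mul0r (fnorm_eq0 A0) -(scale0r 0) fdotZl mul0r.
have [B0|B0] := eqVneq (fnorm B) 0.
  by rewrite B0 mulr0 (fnorm_eq0 B0) -(scale0r 0) fdotZr mul0r.
have a0 : 0 < fnorm A by rewrite lt_neqAle eq_sym A0 fnorm_ge0.
have b0 : 0 < fnorm B by rewrite lt_neqAle eq_sym B0 fnorm_ge0.
have := fdot_sqr_ge0 (fnorm B *: A - fnorm A *: B).
rewrite !fdotE -!sqr_fnorm (fdotC B A).
move: (fdot A B) (fnorm A) (fnorm B) a0 b0 => u a b a0 b0 H.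
have : 0 <= (2 * (a * b)) * (a * b - u) by apply: le_trans H _; lra.
by rewrite pmulr_rge0 ?mulr_gt0// subr_ge0.
Qed.

Lemma fnormD A B : fnorm (A + B) <= fnorm A + fnorm B.
Proof.
rewrite -ler_sqr ?nnegrE ?addr_ge0 ?fnorm_ge0// sqr_fnorm !fdotE (fdotC B A) -!sqr_fnorm.
have := fdot_le A B; lra.
Qed.

(** The norm of matrices as a normed module is the largest absolute entry, whereas strong
    semismoothness is stated in the Frobenius norm; the estimates are transferred between the two at
    the cost of a factor 3. *)
Lemma mx_norm_le_fnorm A : `|A| <= fnorm A.
Proof.
rewrite /Num.norm /= mx_normrE; elim/big_ind: _ => [|x y xA yA|i _].
- exact: fnorm_ge0.
- by rewrite ge_max xA.
- exact: normr_coord_fnorm.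
Qed.

Lemma normr_coord_le A i j : `|A i j| <= `|A|.
Proof.
rewrite [in leRHS]/Num.norm /= mx_normrE.
by rewrite (bigD1 (i, j))//= le_max lexx.
Qed.

Lemma fnorm_le_mx_norm A : fnorm A <= 3 * `|A|.
Proof.
rewrite -ler_sqr ?nnegrE ?fnorm_ge0 ?mulr_ge0// sqr_fnorm.
have H : fdot A A <= \sum_(i < 3) \sum_(j < 3) `|A| ^+ 2.
  apply: ler_sum => i _; apply: ler_sum => j _; rewrite -expr2 -real_normK ?num_real//.
  by rewrite ler_sqr ?nnegrE// normr_coord_le.
apply: (le_trans H); rewrite !sumr_const !card_ord exprMn -mulrnA
   -[leLHS]mulr_natl ler_wpM2r ?exprn_ge0//; lra.
Qed.

Lemma mx3_linear_bounded (W : normedModType R) (f : {linear 'M[R]_3 -> W}) :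
  forall A, `|f A| <= (\sum_(i < 3) \sum_(j < 3) `|f (delta_mx i j)|) * `|A|.
Proof.
move=> A; rewrite {1}(matrix_sum_delta A) linear_sum.
apply: le_trans (ler_norm_sum _ _ _) _; rewrite mulr_suml ler_sum// => i _.
rewrite linear_sum; apply: le_trans (ler_norm_sum _ _ _) _.
rewrite mulr_suml ler_sum// => j _.
by rewrite linearZ normrZ mulrC ler_wpM2l// normr_coord_le.
Qed.

Lemma mx3_linear_semis (W : normedModType R) (f : {linear 'M[R]_3 -> W}) A : semis f A.
Proof. exact: semis_linear (mx3_linear_bounded f). Qed.

End Frobenius.

(** * Limits of Frechet derivatives and the Clarke Jacobian *)

Section StrongSemismoothness.
Context {R : realType}.
Notation M := 'M[R]_3.
Variables (T F : M -> M).
Hypothesis TF : forall y, symm y -> T y = F y.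

Lemma symmD (A B : M) : symm A -> symm B -> symm (A + B).
Proof. by rewrite /symm linearD /= => -> ->. Qed.

Lemma symmZ a (A : M) : symm A -> symm (a *: A).
Proof. by rewrite /symm linearZ /= => ->. Qed.

Lemma symmN (A : M) : symm A -> symm (- A).
Proof. by rewrite -scaleN1r; exact: symmZ. Qed.

(** [F] extends [T] from the symmetric matrices to the whole normed space, where the calculus takes
    place; derivatives of the two can be compared only at symmetric points along symmetric
    directions. *)
Lemma frechet_dirderiv y L u : symm y -> symm u -> frechet_at T y L ->
  dirderiv F y u (L u).
Proof.
move=> sy su [Llin Lder] e e0.
have s0 : symm (0 : M) by rewrite /symm trmx0.
have L0 : L 0 = 0.
  have /eqP := Llin 1 0 0 s0 s0.
  by rewrite scaler0 addr0 scale1r -subr_eq0 opprD addNKr oppr_eq0 => /eqP.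
have LZ t : L (t *: u) = t *: L u by have := Llin t u 0 su s0; rewrite L0 !addr0.
have k0 : 0 < fnorm u + 1 by have := fnorm_ge0 u; lra.
have e1 : 0 < e / (fnorm u + 1) by rewrite divr_gt0.
have [d [d0 Hd]] := Lder _ e1.
exists (d / (fnorm u + 1)); first by rewrite divr_gt0.
move=> t t0; rewrite ltr_pdivlMr// => td.
have tu : fnorm (t *: u) = t * fnorm u by rewrite fnormZ gtr0_norm.
have stu := symmZ t su.
have := Hd _ stu; rewrite tu -!TF; [|exact: sy|exact: symmD].
have utd : t * fnorm u < d by lra.
move=> /(_ utd) H; rewrite -LZ; apply: le_trans (mx_norm_le_fnorm _) _.
apply: le_trans H _; rewrite mulrAC ler_pdivrMr//.
have := mulr_gt0 e0 t0; have := fnorm_ge0 u; nra.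
Qed.

(** At an approximating point the Frechet derivative is applied to h + u with u small. It is linear,
    and the Lipschitz constant of F bounds it on symmetric matrices uniformly along the sequence, so
    the terms in u vanish in the limit. *)
Lemma B_jac_estimate x r C h V : symm x -> semis_in F x r C -> 0 < C ->
  symm h -> `|h| < r -> B_jac T (x + h) V ->
  `|F (x + h) - F x - V h| <= C * `|h| ^+ 2.
Proof.
move=> sx [L S] C0 sh hr [xs [Ls [sxs [xsx [Dxs LsV]]]]].
have xhr : `|x + h - x| < r by rewrite addrC addKr.
apply/ler_addgt0Pr => e e0.
have r0 : 0 < r by apply: le_lt_trans hr.
(* The errors in u are C |u| for moving F from x + h to [yk], C |u| for [Lk u], and C (2 r + 1) |u|
   from expanding |h + u|^2 with |h| < r and |u| < 1. *)
pose K := C * (2 * r + 3); have K0 : 0 < K by rewrite mulr_gt0//; lra.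
pose eta := Num.min (Num.min 1 (r - `|h|)) (e / 2 / K).
have eta0 : 0 < eta by rewrite !lt_min ltr01 subr_gt0 hr !divr_gt0.
have [N1 HN1] := xsx _ eta0.
have e20 : 0 < e / 2 by lra.
have [N2 HN2] := LsV h sh _ e20.
pose k := maxn N1 N2; set yk := xs k; set Lk := Ls k.
have Hu : `|yk - (x + h)| < eta.
  by apply: le_lt_trans (mx_norm_le_fnorm _) _; apply: HN1; exact: leq_maxl.
have HV : `|Lk h - V h| < e / 2.
  by apply: le_lt_trans (mx_norm_le_fnorm _) _; apply: HN2; exact: leq_maxr.
set u := yk - (x + h) in Hu.
have su : symm u by apply: symmD (sxs k) (symmN (symmD sx sh)).
have yx : yk - x = h + u by rewrite /u; zmod_ring.
move: Hu; rewrite !lt_min ltr_pdivlMr// => /andP[/andP[u1 ur] uK].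
have ykr : `|yk - x| < r by rewrite yx; apply: le_lt_trans (ler_normD _ _) _; lra.
have Dk w : symm w -> dirderiv F yk w (Lk w).
  by move=> sw; exact: frechet_dirderiv (sxs k) sw (Dxs k).
have s0 : symm (0 : M) by rewrite /symm trmx0.
have [_ [d Hd He]] := S _ ykr.
have dE : d = Lk h + Lk u.
  have -> : d = Lk (h + u).
    by rewrite -yx; apply: dirderiv_uniq Hd (Dk _ _); rewrite yx; exact: symmD.
  by have [Llin _] := Dxs k; have := Llin 1 h u sh su; rewrite !scale1r.
have D0 : dirderiv F yk 0 0.
  move=> e' e'0; exists 1 => // t t0 _; rewrite !scaler0 addr0 subrr subr0 normr0.
  by rewrite mulr_ge0// ltW.
have Lu : `|Lk u| <= C * `|u|.
  by have := dirderiv_lip L ykr (Dk _ su) D0; rewrite !subr0.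
have Fu : `|F (x + h) - F yk| <= C * `|u|.
  by have := L _ _ xhr ykr; rewrite (distrC (x + h)).
have -> : F (x + h) - F x - V h =
   (F (x + h) - F yk) + ((F yk - F x - d) + (Lk u + (Lk h - V h))).
  by rewrite dE; zmod_ring.
apply: le_trans (ler_normD _ _) _.
apply: le_trans (lerD (lexx _) (ler_normD _ _)) _.
apply: le_trans (lerD (lexx _) (lerD (lexx _) (ler_normD _ _))) _.
have n0 := normr_ge0 u; have n1 := normr_ge0 h.
have Hq : `|yk - x| ^+ 2 <= `|h| ^+ 2 + (2 * r + 1) * `|u|.
  rewrite yx; apply: (@le_trans _ _ ((`|h| + `|u|) ^+ 2)).
    by rewrite ler_sqr ?nnegrE ?addr_ge0// ler_normD.
  nra.
have := ler_wpM2l (ltW C0) Hq; move: uK; rewrite /K; lra.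
Qed.

Lemma semis_strongly_semismooth x : symm x -> semis F x -> strongly_semismooth_at T x.
Proof.
move=> sx SF; have [r [C [r0 C0 SI]]] := SF; have [L _] := SI.
have nM (A B : M) : `|A - B| <= fnorm (A - B) by exact: mx_norm_le_fnorm.
split; [|split].
- exists r, (3 * C); split=> // y z sy sz yr zr.
  rewrite !TF//; apply: le_trans (fnorm_le_mx_norm _) _; rewrite -mulrA ler_pM2l//.
  apply: le_trans (L _ _ (le_lt_trans (nM _ _) yr) (le_lt_trans (nM _ _) zr)) _.
  by rewrite ler_pM2l.
- move=> h sh; have [d Hd] := semis_ddiff h SF.
  exists d => e e0; have e4 : 0 < e / 4 by lra.
  have [s s0 Hs] := Hd _ e4; exists s; split=> // t t0 ts.
  rewrite !TF//; last by apply: symmD => //; exact: symmZ.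
  apply: le_lt_trans (fnorm_le_mx_norm _) _.
  have -> : t^-1 *: (F (x + t *: h) - F x) - d = t^-1 *: (F (x + t *: h) - F x - t *: d).
    by rewrite [in RHS]scalerBr scalerA mulVf ?scale1r// gt_eqF.
  rewrite normrZ gtr0_norm ?invr_gt0//.
  have := ler_wpM2l (ltW (_ : 0 < t^-1)) (Hs t t0 ts); rewrite invr_gt0 => /(_ t0).
  have -> : t^-1 * (e / 4 * t) = e / 4 by field; rewrite gt_eqF.
  lra.
- exists (3 * C), r; split=> // h V sh hr [n [Vs [w [HB [w0 [w1 HV]]]]]].
  have hr' : `|h| < r by exact: le_lt_trans (mx_norm_le_fnorm _) hr.
  rewrite !TF//; last exact: symmD.
  apply: le_trans (fnorm_le_mx_norm _) _; rewrite -mulrA ler_pM2l//.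
  have -> : F (x + h) - F x - V h = \sum_(i < n) w i *: (F (x + h) - F x - Vs i h).
    under eq_bigr do rewrite scalerBr.
    by rewrite sumrB -scaler_suml w1 scale1r -HV.
  apply: le_trans (ler_norm_sum _ _ _) _.
  apply: (@le_trans _ _ (\sum_(i < n) w i * (C * `|h| ^+ 2))).
    apply: ler_sum => i _; rewrite normrZ (ger0_norm (w0 i)) ler_wpM2l//.
    exact: B_jac_estimate sx SI C0 sh hr' (HB i).
  rewrite -mulr_suml w1 mul1r ler_pM2l// ler_sqr ?nnegrE ?fnorm_ge0//.
  exact: mx_norm_le_fnorm.
Qed.

End StrongSemismoothness.

(** * Maxima of linear functionals *)

Section MaxOfLinear.
Context {R : realType} (V : normedModType R) (I : Type).
Variables (l : I -> V -> R) (f : V -> R) (C : R).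
Hypothesis C0 : 0 < C.
Hypothesis lD : forall i u v a, l i (u + a *: v) = l i u + a * l i v.
Hypothesis lC : forall i h, l i h <= C * `|h|.
Hypothesis lf : forall i y, l i y <= f y.
Hypothesis fl : forall y, exists i, l i y = f y.

Let lB i u v : l i (u - v) = l i u - l i v.
Proof. by rewrite -scaleN1r lD mulN1r. Qed.

Let lZ i a u : l i (a *: u) = a * l i u.
Proof.
by have l0 := lB i 0 0; rewrite !subrr in l0; rewrite -[a *: u]add0r lD l0 add0r.
Qed.

Lemma max_linear_lip y z : `|f y - f z| <= C * `|y - z|.
Proof.
have H u v : f u - f v <= C * `|u - v|.
  have [i <-] := fl u; apply: le_trans (lC i _); rewrite lB lerD2l lerN2; exact: lf.
by rewrite ler_norml lerNl opprB H distrC H.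
Qed.

(** By convexity the difference quotients increase with t, so the derivative is their infimum (minus
    the supremum of their opposites) and a lower bound for each of them. *)
Lemma max_linear_dirderiv y h : exists d : R, dirderiv (f : V -> R^o) y h d /\
  forall t, 0 < t -> t * d <= f (y + t *: h) - f y.
Proof.
pose g t := (f (y + t *: h) - f y) / t.
pose E : set R := [set - g t | t in [set t | 0 < t]]%classic.
have lb t : 0 < t -> - g t <= C * `|h|.
  move=> t0; rewrite /g -mulNr opprB ler_pdivrMr//.
  have := max_linear_lip y (y + t *: h); rewrite opprD addNKr normrN normrZ gtr0_norm//.
  by rewrite ler_norml => /andP[_]; lra.
have hE : has_sup E.
  by split; [exists (- g 1), 1 => //=|exists (C * `|h|) => _ [t /= t0 <-]; exact: lb].
have mono s t : 0 < s -> s <= t -> g s <= g t.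
  move=> s0 st; have t0 : 0 < t by exact: lt_le_trans st.
  rewrite /g ler_pdivrMr// mulrAC ler_pdivlMr//.
  have [i Hi] := fl (y + s *: h); rewrite -Hi lD.
  have H1 := lf i (y + t *: h); have H2 := lf i y; rewrite lD in H1.
  have : s * (l i y + t * l i h - f y) <= s * (f (y + t *: h) - f y).
    by rewrite ler_pM2l// lerD2r.
  have : (t - s) * l i y <= (t - s) * f y by rewrite ler_wpM2l// subr_ge0.
  lra.
exists (- sup E); split.
  move=> e e0; have [_ [s /= s0 <-] se] := sup_adherent e0 hE.
  exists s => // t t0 ts.
  have H1 : - g t <= sup E by apply: sup_upper_bound => //; exists t.
  have H2 := mono _ _ t0 (ltW ts).
  have -> : f (y + t *: h) - f y - t *: (- sup E : R^o) = t * (g t + sup E).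
    by rewrite /g /GRing.scale /=; field; rewrite gt_eqF.
  rewrite normrM gtr0_norm// mulrC ler_pM2r// ger0_norm; lra.
move=> t t0; have H1 : - g t <= sup E by apply: sup_upper_bound => //; exists t.
rewrite mulrC -ler_pdivlMr// -/(g t); lra.
Qed.

(** Convexity alone gives f y - f x <= d. The converse needs the hypothesis that some functional
    active at a point near x is almost active at x, up to a quadratic gap. *)
Lemma semis_max_linear x :
  (forall y, exists2 i, l i y = f y & f x - l i x <= C * `|y - x| ^+ 2) -> semis (f : V -> R^o) x.
Proof.
move=> Hx; exists 1, C; split=> //; split=> [y z _ _|y _]; first exact: max_linear_lip.
split=> [h|]; first by have [d [Hd _]] := max_linear_dirderiv y h; exists d.
have [d [Hd dle]] := max_linear_dirderiv y (y - x); exists d => //.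
set h := y - x in Hd dle *.
have n0 := normr_ge0 h; have q0 := exprn_ge0 2 n0.
have Cq := mulr_ge0 (ltW C0) q0; have Cn := mulr_ge0 (ltW C0) n0.
rewrite ler_norml; apply/andP; split.
  suff : d <= f y - f x + C * `|h| ^+ 2 by lra.
  apply/ler_addgt0Pr => e e0.
  (* [B] collects the coefficients of t: C |h| from the Lipschitz bound, 3 C |h|^2 from (1 + t)^2 -
     1 <= 3 t, and |d|; adding 1 makes it positive. *)
  pose B := C * `|h| + 3 * (C * `|h| ^+ 2) + `|d| + 1.
  have B0 : 0 < B by rewrite /B; have := normr_ge0 d; lra.
  pose t := Num.min 1 (e / B).
  have t0 : 0 < t by rewrite lt_min ltr01 divr_gt0.
  have t1 : t <= 1 by rewrite ge_min lexx.
  have tB : t * B <= e by rewrite -ler_pdivlMr// ge_min lexx orbT.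
  (* A functional active at y satisfies only [l i h <= d]; one active slightly beyond y satisfies
     [d <= l i h], which is the direction needed here. *)
  have [i Hi {}Hx] := Hx (y + t *: h).
  have Hf := max_linear_lip (y + t *: h) y.
  rewrite [y + t *: h]addrC addrK normrZ (gtr0_norm t0) [t *: h + y]addrC in Hf.
  have {Hf} := le_trans (ler_norm _) Hf.
  have Hz := dle _ t0.
  have zx : y + t *: h - x = (1 + t) *: h.
    by rewrite scalerDl scale1r /h; zmod_ring.
  rewrite zx normrZ gtr0_norm ?exprMn in Hx; last by lra.
  have lih : t * d <= t * l i h.
    by apply: le_trans Hz _; rewrite -Hi lD; have := lf i y; lra.
  rewrite ler_pM2l// in lih.
  have Hl : (1 + t) * l i h = f (y + t *: h) - l i x.
    by rewrite -Hi -lB zx lZ.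
  have : (1 + t) * d <= (1 + t) * l i h by rewrite ler_pM2l//; lra.
  rewrite Hl => H1 H2.
  have H3 : t * t * (C * `|h| ^+ 2) <= t * (C * `|h| ^+ 2).
    by rewrite ler_wpM2r// -[leRHS]mulr1 ler_wpM2l// ltW.
  have H4 : - (t * `|d|) <= t * d.
    by rewrite -mulrN ler_wpM2l ?(ltW t0)// lerNl -normrN ler_norm.
  rewrite /B in tB; lra.
suff : f y - f x <= d by lra.
have [i Hi] := fl y.
have -> : f y - f x = (l i h) + (l i x - f x) by rewrite /h lB -Hi; lra.
suff : l i h <= d by have := lf i x; lra.
apply/ler_addgt0Pr => e e0; have [r r0 Hr] := Hd _ e0.
have t0 : 0 < r / 2 by lra.
have tr : r / 2 < r by lra.
have := Hr _ t0 tr; move: (r / 2) t0 => t t0; rewrite ler_norml => /andP[_].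
have := lf i (y + t *: h); rewrite lD Hi /GRing.scale /= => H1 H2.
rewrite -(ler_pM2l t0); lra.
Qed.

End MaxOfLinear.

(** * Singular positive semidefinite ternary quadratic forms *)

Section QuadraticForms.
Context {R : realType}.
Implicit Types a b c d e f x y z : R.

Lemma ge0_of_pairwise a b c : 0 <= a * b -> 0 <= a * c -> 0 <= b * c ->
  0 <= a + b + c -> [/\ 0 <= a, 0 <= b & 0 <= c].
Proof.
have H x y z : 0 <= x * y -> 0 <= x * z -> 0 <= x + y + z -> 0 <= x.
  move=> xy xz s; rewrite leNgt; apply/negP => x0.
  by move: xy xz; rewrite !nmulr_rge0// => y0 z0; lra.
move=> ab ac bc s; split; first exact: H ab ac s.
- by apply: (H b a c); rewrite ?(mulrC b a) ?(addrC b a).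
- by apply: (H c a b); rewrite ?(mulrC c) // -addrA addrC.
Qed.

Lemma psd2 a b c y z : 0 <= a -> 0 <= b -> c ^+ 2 = a * b ->
  0 <= a * y ^+ 2 + b * z ^+ 2 + 2 * c * y * z.
Proof.
move=> a0 b0 cab; have [a1|a1] := eqVneq a 0.
  have c0 : c = 0 by apply/eqP; rewrite -sqrf_eq0 cab a1 mul0r.
  by rewrite a1 c0; have := mulr_ge0 b0 (sqr_ge0 z); lra.
have ap : 0 < a by rewrite lt_neqAle eq_sym a1.
rewrite -(pmulr_rge0 _ ap).
have -> : a * (a * y ^+ 2 + b * z ^+ 2 + 2 * c * y * z) = (a * y + c * z) ^+ 2.
  have -> : (a * y + c * z) ^+ 2 = a ^+ 2 * y ^+ 2 + c ^+ 2 * z ^+ 2 + 2 * a * c * y * z by ring.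
  by rewrite cab; ring.
exact: sqr_ge0.
Qed.

(* For the symmetric matrix [[a, d, e], [d, b, f], [e, f, c]]. *)
Definition det3 a b c d e f :=
  a * b * c + 2 * d * e * f - a * f ^+ 2 - b * e ^+ 2 - c * d ^+ 2.
Definition quad3 a b c d e f x y z :=
  a * x ^+ 2 + b * y ^+ 2 + c * z ^+ 2 + 2 * d * x * y + 2 * e * x * z + 2 * f * y * z.

(** The adjugate of a singular 3x3 matrix has rank at most one, so its 2x2 minors vanish: each
    squared off-diagonal cofactor is the product of two principal ones. These thus have nonnegative
    pairwise products, and their sum fixes the sign. *)
Lemma cofactors_ge0 a b c d e f : det3 a b c d e f = 0 ->
  0 <= (a * b - d ^+ 2) + (a * c - e ^+ 2) + (b * c - f ^+ 2) ->
  [/\ 0 <= a * b - d ^+ 2, 0 <= a * c - e ^+ 2, 0 <= b * c - f ^+ 2,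
      (a * f - d * e) ^+ 2 = (a * b - d ^+ 2) * (a * c - e ^+ 2) &
      (b * e - d * f) ^+ 2 = (a * b - d ^+ 2) * (b * c - f ^+ 2) /\
      (c * d - e * f) ^+ 2 = (a * c - e ^+ 2) * (b * c - f ^+ 2)].
Proof.
move=> D s.
have E1 : (a * f - d * e) ^+ 2 = (a * b - d ^+ 2) * (a * c - e ^+ 2).
  by apply/eqP; rewrite eq_sym -subr_eq0 -[X in _ == X](mulr0 a) -D /det3; apply/eqP; ring.
have E2 : (b * e - d * f) ^+ 2 = (a * b - d ^+ 2) * (b * c - f ^+ 2).
  by apply/eqP; rewrite eq_sym -subr_eq0 -[X in _ == X](mulr0 b) -D /det3; apply/eqP; ring.
have E3 : (c * d - e * f) ^+ 2 = (a * c - e ^+ 2) * (b * c - f ^+ 2).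
  by apply/eqP; rewrite eq_sym -subr_eq0 -[X in _ == X](mulr0 c) -D /det3; apply/eqP; ring.
have P1 := sqr_ge0 (a * f - d * e); have P2 := sqr_ge0 (b * e - d * f).
have P3 := sqr_ge0 (c * d - e * f); rewrite E1 in P1; rewrite E2 in P2; rewrite E3 in P3.
by have [] := ge0_of_pairwise P1 P2 P3 s.
Qed.

(** Completing the square in x leaves a binary form in y and z with zero discriminant. *)
Lemma psd3_pos a b c d e f x y z : 0 < a ->
  0 <= a * b - d ^+ 2 -> 0 <= a * c - e ^+ 2 ->
  (a * f - d * e) ^+ 2 = (a * b - d ^+ 2) * (a * c - e ^+ 2) ->
  0 <= quad3 a b c d e f x y z.
Proof.
move=> a0 m3 m2 E; rewrite -(pmulr_rge0 _ a0).
have -> : a * quad3 a b c d e f x y z = (a * x + d * y + e * z) ^+ 2 +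
   ((a * b - d ^+ 2) * y ^+ 2 + (a * c - e ^+ 2) * z ^+ 2 + 2 * (a * f - d * e) * y * z).
  by rewrite /quad3; ring.
by rewrite addr_ge0 ?sqr_ge0// psd2.
Qed.

Lemma diag3_ge0 a b c d e f :
  0 <= a * b - d ^+ 2 -> 0 <= a * c - e ^+ 2 -> 0 <= b * c - f ^+ 2 ->
  0 <= a + b + c -> [/\ 0 <= a, 0 <= b & 0 <= c].
Proof.
move=> m3 m2 m1 s.
have ab : 0 <= a * b by have := sqr_ge0 d; lra.
have ac : 0 <= a * c by have := sqr_ge0 e; lra.
have bc : 0 <= b * c by have := sqr_ge0 f; lra.
exact: ge0_of_pairwise ab ac bc s.
Qed.

Lemma offdiag3_eq0 a b c d e f :
  0 <= a * b - d ^+ 2 -> 0 <= a * c - e ^+ 2 -> 0 <= b * c - f ^+ 2 ->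
  a = 0 -> b = 0 -> c = 0 -> [/\ d = 0, e = 0 & f = 0].
Proof.
move=> m3 m2 m1 a0 b0 c0; move: m3 m2 m1; rewrite a0 b0 c0 mul0r !sub0r !oppr_ge0.
by split; apply/eqP; rewrite -sqrf_eq0 eq_le sqr_ge0 andbT.
Qed.

(** The hypotheses concern the coefficients of the characteristic polynomial only. A nonzero
    diagonal entry is positive and can be permuted to the front; if there is none, the matrix is
    zero. *)
Lemma psd3 a b c d e f x y z : det3 a b c d e f = 0 -> 0 <= a + b + c ->
  0 <= (a * b - d ^+ 2) + (a * c - e ^+ 2) + (b * c - f ^+ 2) ->
  0 <= quad3 a b c d e f x y z.
Proof.
move=> D s1 s2; have [m3 m2 m1 E1 [E2 E3]] := cofactors_ge0 D s2.
have [a0 b0 c0] := diag3_ge0 m3 m2 m1 s1.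
have [az|an] := eqVneq a 0; last by apply: psd3_pos; rewrite // lt_neqAle eq_sym an.
have [bz|bn] := eqVneq b 0; last first.
  have -> : quad3 a b c d e f x y z = quad3 b a c d f e y x z by rewrite /quad3; ring.
  apply: psd3_pos; rewrite ?(mulrC b a)//; first by rewrite lt_neqAle eq_sym bn.
have [cz|cn] := eqVneq c 0; last first.
  have -> : quad3 a b c d e f x y z = quad3 c a b e f d z x y by rewrite /quad3; ring.
  apply: psd3_pos; rewrite ?(mulrC c a) ?(mulrC c b)//; first by rewrite lt_neqAle eq_sym cn.
have [dz ez fz] := offdiag3_eq0 m3 m2 m1 az bz cz.
by rewrite /quad3 az bz cz dz ez fz !(mul0r, mulr0, addr0).
Qed.

(* If the sum e2 of the principal 2x2 minors is positive, this follows from the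
   Cayley-Hamilton identity A^3 - e1 A^2 + e2 A = 0; if e2 = 0 then adj A = 0,
   that is A^2 = e1 A. *)
Lemma psd3_le_sqr a b c d e f : det3 a b c d e f = 0 -> 0 <= a + b + c ->
  0 <= (a * b - d ^+ 2) + (a * c - e ^+ 2) + (b * c - f ^+ 2) ->
  exists2 C, 0 < C & forall x y z, quad3 a b c d e f x y z <=
    C * ((a * x + d * y + e * z) ^+ 2 + (d * x + b * y + f * z) ^+ 2 +
         (e * x + f * y + c * z) ^+ 2).
Proof.
move=> D s1 s2; have psd := fun x y z => psd3 x y z D s1 s2.
have [m3 m2 m1 E1 [E2 E3]] := cofactors_ge0 D s2.
set e2 := _ + (b * c - f ^+ 2) in s2.
have [z2|n2] := eqVneq e2 0; last first.
  have p2 : 0 < e2 by rewrite lt_neqAle eq_sym n2.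
  exists ((a + b + c + 1) / e2); first by rewrite divr_gt0//; lra.
  move=> x y z; set w1 := a * x + _ + _; set w2 := d * x + _ + _; set w3 := e * x + _ + _.
  rewrite mulrAC ler_pdivlMr//.
  have -> : quad3 a b c d e f x y z * e2 = (a + b + c) * (w1 ^+ 2 + w2 ^+ 2 + w3 ^+ 2)
     - quad3 a b c d e f w1 w2 w3 + det3 a b c d e f * (x ^+ 2 + y ^+ 2 + z ^+ 2).
    by rewrite /quad3 /det3 /e2 /w1 /w2 /w3; ring.
  have := psd w1 w2 w3; rewrite D.
  have := sqr_ge0 w1; have := sqr_ge0 w2; have := sqr_ge0 w3; lra.
have [a0 b0 c0] := diag3_ge0 m3 m2 m1 s1.
have k1 : b * c - f ^+ 2 = 0 by rewrite /e2 in z2; lra.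
have k2 : a * c - e ^+ 2 = 0 by rewrite /e2 in z2; lra.
have k3 : a * b - d ^+ 2 = 0 by rewrite /e2 in z2; lra.
have h1 : a * f - d * e = 0 by apply/eqP; rewrite -sqrf_eq0 E1 k2 mulr0.
have h2 : b * e - d * f = 0 by apply/eqP; rewrite -sqrf_eq0 E2 k1 mulr0.
have h3 : c * d - e * f = 0 by apply/eqP; rewrite -sqrf_eq0 E3 k1 mulr0.
have sq x y z : (a * x + d * y + e * z) ^+ 2 + (d * x + b * y + f * z) ^+ 2 +
         (e * x + f * y + c * z) ^+ 2 = (a + b + c) * quad3 a b c d e f x y z.
  have -> : (a * x + d * y + e * z) ^+ 2 + (d * x + b * y + f * z) ^+ 2 +
         (e * x + f * y + c * z) ^+ 2 = (a + b + c) * quad3 a b c d e f x y z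
     - (a * b - d ^+ 2) * (x ^+ 2 + y ^+ 2)
     - (a * c - e ^+ 2) * (x ^+ 2 + z ^+ 2)
     - (b * c - f ^+ 2) * (y ^+ 2 + z ^+ 2)
     - 2 * (c * d - e * f) * x * y - 2 * (b * e - d * f) * x * z
     - 2 * (a * f - d * e) * y * z.
    by rewrite /quad3; ring.
  by rewrite k1 k2 k3 h1 h2 h3; ring.
have [e1|n1] := eqVneq (a + b + c) 0.
  exists 1 => // x y z; rewrite sq e1.
  have az : a = 0 by lra.
  have bz : b = 0 by lra.
  have cz : c = 0 by lra.
  have [dz ez fz] := offdiag3_eq0 m3 m2 m1 az bz cz.
  by rewrite /quad3 az bz cz dz ez fz; lra.
exists (a + b + c)^-1; first by rewrite invr_gt0 lt_neqAle eq_sym n1.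
by move=> x y z; rewrite sq mulKf.
Qed.

End QuadraticForms.

(** * The largest eigenvalue of a symmetric traceless matrix *)

Section TopEigenvalue.
Context {R : realType}.
Implicit Types (A S X : 'M[R]_3) (v : 'rV[R]_3).

Lemma sum3E (W : nmodType) (F : 'I_3 -> W) : \sum_(i < 3) F i = F 0 + F 1 + F 2.
Proof.
rewrite !big_ord_recl big_ord0 addr0 addrA.
by congr (F _ + F _ + F _); exact: val_inj.
Qed.

Lemma det3E A : symm A ->
  \det A = det3 (A 0 0) (A 1 1) (A 2 2) (A 0 1) (A 0 2) (A 1 2).
Proof.
move=> sA; have sE i j : A i j = A j i by rewrite -[in LHS]sA mxE.
have l0 : lift (0 : 'I_3) (0 : 'I_2) = 1 by exact: val_inj.
have l1 : lift (0 : 'I_3) (1 : 'I_2) = 2 by exact: val_inj.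
have l2 : lift (1 : 'I_3) (0 : 'I_2) = 0 by exact: val_inj.
have l3 : lift (1 : 'I_3) (1 : 'I_2) = 2 by exact: val_inj.
have l4 : lift (2 : 'I_3) (0 : 'I_2) = 0 by exact: val_inj.
have l5 : lift (2 : 'I_3) (1 : 'I_2) = 1 by exact: val_inj.
have k0 : lift (0 : 'I_2) (0 : 'I_1) = 1 by exact: val_inj.
have k1 : lift (1 : 'I_2) (0 : 'I_1) = 0 by exact: val_inj.
have s2 (F : 'I_2 -> R) : \sum_(i < 2) F i = F 0 + F 1.
  by rewrite !big_ord_recl big_ord0 addr0; congr (F _ + F _); exact: val_inj.
have d2 (B : 'M[R]_2) : \det B = B 0 0 * B 1 1 - B 0 1 * B 1 0.
  by rewrite (expand_det_row _ 0) s2 /cofactor !det_mx11 !mxE k0 k1 /= expr0 expr1; ring.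
rewrite (expand_det_row _ 0) sum3E /cofactor !d2 !mxE !(l0, l1, l2, l3, l4, l5).
rewrite (sE 1 0) (sE 2 0) (sE 2 1) /det3 /=.
have -> : (0 + 2 %% 3)%N = 2 by [].
by rewrite !expr0 !expr1 sqrrN expr1n; ring.
Qed.

(** The value v A v^T, as a Frobenius product, so that linearity in A and the Cauchy-Schwarz bound
    come from [fdot]. *)
Definition quadf A v : R := fdot A (v^T *m v).
Definition sqn v : R := \sum_(i < 3) v 0 i ^+ 2.

Lemma outerE v i j : (v^T *m v) i j = v 0 i * v 0 j.
Proof. by rewrite mxE big_ord1 mxE. Qed.

Lemma fdotE3 A B : fdot A B = A 0 0 * B 0 0 + A 0 1 * B 0 1 + A 0 2 * B 0 2
  + (A 1 0 * B 1 0 + A 1 1 * B 1 1 + A 1 2 * B 1 2)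
  + (A 2 0 * B 2 0 + A 2 1 * B 2 1 + A 2 2 * B 2 2).
Proof. by rewrite /fdot !sum3E. Qed.

Lemma fdot_Id3 A : fdot (Id3 R) A = A 0 0 + A 1 1 + A 2 2.
Proof. by rewrite fdotE3 !mxE /=; ring. Qed.

Lemma quadfE A v : symm A -> quadf A v =
  quad3 (A 0 0) (A 1 1) (A 2 2) (A 0 1) (A 0 2) (A 1 2) (v 0 0) (v 0 1) (v 0 2).
Proof.
move=> sA; have sE i j : A i j = A j i by rewrite -[in LHS]sA mxE.
by rewrite /quadf fdotE3 !outerE (sE 1 0) (sE 2 0) (sE 2 1) /quad3; ring.
Qed.

Lemma sqnE v : sqn v = v 0 0 ^+ 2 + v 0 1 ^+ 2 + v 0 2 ^+ 2.
Proof. by rewrite /sqn sum3E. Qed.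

Lemma fdot_outer v : fdot (v^T *m v) (v^T *m v) = sqn v ^+ 2.
Proof. by rewrite fdotE3 !outerE sqnE; ring. Qed.

Lemma fdot_Id3_outer v : fdot (Id3 R) (v^T *m v) = sqn v.
Proof. by rewrite fdot_Id3 !outerE sqnE; ring. Qed.

Lemma fdot_Id3_Id3 : fdot (Id3 R) (Id3 R) = 3.
Proof. by rewrite fdot_Id3 !mxE /=; ring. Qed.

Lemma symm_Id3 : symm (Id3 R).
Proof. exact: trmx1. Qed.

Lemma quadf_eigen A v t : v *m A = t *: v -> quadf A v = t * sqn v.
Proof.
move=> H; have E j : v 0 0 * A 0 j + v 0 1 * A 1 j + v 0 2 * A 2 j = t * v 0 j.
  by have := congr1 (fun w : 'rV_3 => w 0 j) H; rewrite !mxE sum3E.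
have := E 0; have := E 1; have := E 2; rewrite /quadf fdotE3 !outerE sqnE => E2 E1 E0.
have -> : t * (v 0 0 ^+ 2 + v 0 1 ^+ 2 + v 0 2 ^+ 2) =
   t * v 0 0 * v 0 0 + t * v 0 1 * v 0 1 + t * v 0 2 * v 0 2 by ring.
by rewrite -E0 -E1 -E2; ring.
Qed.

Lemma unit_eigenvector A t : \det (t%:M - A) = 0 ->
  exists2 v, sqn v = 1 & v *m A = t *: v.
Proof.
move/eqP/det0P => [v v0 vA].
have {}vA : v *m A = t *: v.
  by apply/eqP; rewrite eq_sym -subr_eq0 -mul_mx_scalar -mulmxBr vA.
have n0 : 0 < sqn v.
  rewrite lt_neqAle sumr_ge0 ?andbT => [|i _]; last exact: sqr_ge0.
  apply: contra v0 => /eqP n0; apply/eqP/rowP => i; rewrite mxE; apply/eqP.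
  rewrite -sqrf_eq0 eq_le sqr_ge0 andbT [leRHS]n0 /sqn (bigD1 i)//= lerDl.
  by apply: sumr_ge0 => j _; exact: sqr_ge0.
exists ((Num.sqrt (sqn v))^-1 *: v).
  rewrite /sqn; under eq_bigr do rewrite mxE exprMn.
  by rewrite -mulr_sumr exprVn sqr_sqrtr ?ltW// mulVf// gt_eqF.
by rewrite -scalemxAl vA !scalerA mulrC.
Qed.

(* The largest eigenvalue of a symmetric traceless S, by Viete's trigonometric
   solution of the characteristic equation. *)
Definition topev S : R := 2 / Num.sqrt 3 * Num.sqrt (J2 S) * cos (lode S).

Section Traceless.
Variable S : 'M[R]_3.
Hypothesis sS : symm S.
Hypothesis tS : fdot (Id3 R) S = 0.

Lemma dev_traceless : dev S = S.
Proof. by rewrite /dev /pres tS mul0r scale0r subr0. Qed.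

Let sE i j : S i j = S j i.
Proof. by rewrite -[in LHS]sS mxE. Qed.

Let S22 : S 2 2 = - S 0 0 - S 1 1.
Proof. by have := tS; rewrite fdot_Id3; lra. Qed.

Lemma char3 t : \det (t%:M - S) = t ^+ 3 - J2 S * t - J3 S.
Proof.
have sA : symm (t%:M - S) by rewrite /symm linearB /= tr_scalar_mx sS.
rewrite det3E// /J2 /J3 dev_traceless (fdotC _ (Id3 R)) fdot_Id3 fdotE3 !mxE !sum3E.
by rewrite !mxE !sum3E (sE 1 0) (sE 2 0) (sE 2 1) S22 /det3 /=; field.
Qed.

Lemma J2_ge0 : 0 <= J2 S.
Proof. by rewrite divr_ge0// fdot_sqr_ge0. Qed.

(** Cauchy-Schwarz is applied to S and the traceless part B of v^T v, for which S : B = t and |B|^2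
    = 2/3. The quantity 4 J2 - 3 t^2 is the discriminant of the characteristic cubic divided by its
    factor of root t. *)
Lemma eigenvalue_le t v : sqn v = 1 -> v *m S = t *: v -> 3 * t ^+ 2 <= 4 * J2 S.
Proof.
move=> n1 /quadf_eigen; rewrite n1 mulr1 /quadf => tE.
pose B := v^T *m v - 3^-1 *: Id3 R.
have BS : fdot S B = t by rewrite /B !fdotE (fdotC S (Id3 R)) tS tE; ring.
have BB : fdot B B = 2 / 3.
  by rewrite /B !fdotE (fdotC _ (Id3 R)) fdot_outer fdot_Id3_outer fdot_Id3_Id3 n1; field.
have H1 := fdot_le S B; have := fdot_le (- S) B; rewrite fdotNl fnormN BS => H2.
rewrite BS in H1.
have : t ^+ 2 <= (fnorm S * fnorm B) ^+ 2.
  by rewrite -[t ^+ 2]real_normK ?num_real// ler_sqr ?nnegrE ?mulr_ge0 ?fnorm_ge0// ler_norml; lra.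
rewrite exprMn !sqr_fnorm BB /J2 dev_traceless; lra.
Qed.

Lemma real_eigenvalue : exists t, t ^+ 3 - J2 S * t - J3 S = 0.
Proof.
pose p : {poly R} := 'X^3 - J2 S *: 'X - (J3 S)%:P.
have pE t : p.[t] = t ^+ 3 - J2 S * t - J3 S by rewrite !hornerE.
pose B := 1 + J2 S + `|J3 S|.
have j2 := J2_ge0; have j3 := normr_ge0 (J3 S).
have B1 : 1 <= B by rewrite /B; lra.
have key : `|J3 S| <= B ^+ 3 - J2 S * B.
  have -> : B ^+ 3 - J2 S * B = B * (B ^+ 2 - J2 S) by ring.
  have H : `|J3 S| <= B ^+ 2 - J2 S by rewrite /B; nra.
  by apply: (le_trans H); rewrite ler_peMl//; lra.
have [||t _ /rootP] := @poly_ivt R p (- B) B; last by rewrite pE; exists t.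
  lra.
rewrite !pE; have := ler_norm (J3 S); have := ler_norm (- J3 S); rewrite normrN.
have -> : (- B) ^+ 3 = - B ^+ 3 by ring.
lra.
Qed.

(** At a real root t the discriminant 4 J2^3 - 27 J3^2 of the cubic factors as (4 J2 - 3 t^2) (J2 -
    3 t^2)^2. Its sign puts the argument of the arccosine into [-1, 1]. *)
Lemma discriminant_le : 27 * J3 S ^+ 2 <= 4 * J2 S ^+ 3.
Proof.
have [t tE] := real_eigenvalue.
have [v n1 vS] : exists2 v, sqn v = 1 & v *m S = t *: v.
  by apply: unit_eigenvector; rewrite char3.
have := eigenvalue_le n1 vS; rewrite -subr_ge0 => H.
have {}tE : J3 S = t ^+ 3 - J2 S * t by lra.
have := mulr_ge0 H (sqr_ge0 (J2 S - 3 * t ^+ 2)); rewrite tE; lra.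
Qed.

Let X : R := (3 * Num.sqrt 3 / 2) * J3 S / (J2 S * Num.sqrt (J2 S)).

Lemma cos3lode_bound : -1 <= X <= 1.
Proof.
rewrite -ler_norml -(@ler_sqr _ `|X|) ?nnegrE// expr1n real_normK ?num_real//.
(* For J2 = 0 the quotient is 0, since the inverse of 0 is 0. *)
have [j0|j0] := eqVneq (J2 S) 0; first by rewrite /X j0 mul0r invr0 mulr0 expr0n.
have jp : 0 < J2 S by rewrite lt_neqAle eq_sym j0 J2_ge0.
have s3 : Num.sqrt 3 ^+ 2 = 3 :> R by rewrite sqr_sqrtr.
have sj : Num.sqrt (J2 S) ^+ 2 = J2 S by rewrite sqr_sqrtr// ltW.
have -> : X ^+ 2 = (27 / 4) * J3 S ^+ 2 / J2 S ^+ 3.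
  rewrite /X; move: sj j0 jp; move: (Num.sqrt (J2 S)) => q.
  move: (J3 S) (J2 S) => a j sj j0 jp.
  have q0 : q != 0 by rewrite -sqrf_eq0 sj.
  have -> : (3 * Num.sqrt 3 / 2 * a / (j * q)) ^+ 2 =
      9 / 4 * Num.sqrt 3 ^+ 2 * a ^+ 2 / (j ^+ 2 * q ^+ 2).
    by field; rewrite q0 j0.
  by rewrite s3 sj; field.
rewrite ler_pdivrMr ?exprn_gt0// mul1r; have := discriminant_le; lra.
Qed.

Lemma cos3 (x : R) : cos (3 * x) = 4 * cos x ^+ 3 - 3 * cos x.
Proof.
have -> : 3 * x = x *+ 2 + x by ring.
rewrite cosD cos_mulr2n sin_mulr2n.
have -> : (cos x * sin x) *+ 2 * sin x = 2 * cos x * sin x ^+ 2 by ring.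
by rewrite sin2cos2; ring.
Qed.

Lemma cos_lode_eq : 4 * cos (lode S) ^+ 3 - 3 * cos (lode S) = X.
Proof.
by rewrite -cos3 /lode -/X (mulrC 3) divfK ?pnatr_eq0// acosK// in_itv /= cos3lode_bound.
Qed.

(** For c = cos (pi/3) the triple angle formula reads 4 c^3 - 3 c + 1 = (c + 1) (2 c - 1)^2 = 0, and
    c > 0. *)
Lemma cos_pi3 : cos (pi / 3) = 1 / 2 :> R.
Proof.
have p0 := pi_gt0 R.
have : 0 < cos (pi / 3 : R) by apply: cos_gt0_pihalf; lra.
have := cos3 (pi / 3 : R); rewrite (mulrC 3) divfK ?pnatr_eq0// cospi => H c0.
have : (cos (pi / 3) + 1) * (2 * cos (pi / 3) - 1) ^+ 2 = 0 :> R by lra.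
move/eqP; rewrite mulf_eq0 sqrf_eq0 => /orP[] /eqP; lra.
Qed.

(** A third of an arccosine lies in [0, pi/3]. The lower bound singles out the largest root of the
    cubic and keeps the Willam-Warnke denominator away from 0. *)
Lemma cos_lode_bound : 1 / 2 <= cos (lode S) <= 1.
Proof.
rewrite cos_le1 andbT -cos_pi3.
have p0 := pi_gt0 R.
have a0 := acos_ge0 cos3lode_bound; have a1 := acos_lepi cos3lode_bound.
rewrite /lode -/X leNgt ltr_cos ?in_itv /=; lra.
Qed.

Let s3 : Num.sqrt 3 ^+ 2 = 3 :> R.
Proof. by rewrite sqr_sqrtr. Qed.

Let s30 : 0 < Num.sqrt 3 :> R.
Proof. by rewrite sqrtr_gt0. Qed.

Lemma topev_sqr : 3 * topev S ^+ 2 = 4 * J2 S * cos (lode S) ^+ 2.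
Proof.
have sj : Num.sqrt (J2 S) ^+ 2 = J2 S by rewrite sqr_sqrtr// J2_ge0.
rewrite /topev; move: sj; move: (Num.sqrt (J2 S)) => q.
move: (J2 S) (cos _) => j c sj.
have -> : 3 * (2 / Num.sqrt 3 * q * c) ^+ 2 = 12 / Num.sqrt 3 ^+ 2 * q ^+ 2 * c ^+ 2.
  by field; rewrite gt_eqF.
by rewrite s3 sj; field.
Qed.

Lemma topev_root : topev S ^+ 3 - J2 S * topev S - J3 S = 0.
Proof.
have := cos_lode_eq; have [j0|j0] := eqVneq (J2 S) 0.
  have := discriminant_le; rewrite j0 expr0n mulr0 => H _.
  have -> : J3 S = 0.
    by apply/eqP; rewrite -sqrf_eq0 eq_le sqr_ge0 andbT; move: H; rewrite pmulr_rle0.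
  by rewrite /topev j0 sqrtr0 mulr0 mul0r expr0n mulr0 !subr0.
have jp : 0 < J2 S by rewrite lt_neqAle eq_sym j0 J2_ge0.
have sj0 : 0 < Num.sqrt (J2 S) by rewrite sqrtr_gt0.
have sj : J2 S = Num.sqrt (J2 S) ^+ 2 by rewrite sqr_sqrtr// ltW.
rewrite /X => H.
have -> : J3 S = 2 / (3 * Num.sqrt 3) * (J2 S * Num.sqrt (J2 S)) *
    (4 * cos (lode S) ^+ 3 - 3 * cos (lode S)).
  by rewrite H; field; rewrite j0 !gt_eqF.
rewrite /topev; move: sj; move: (Num.sqrt (J2 S)) (cos (lode S)) => q c ->.
have -> : 2 / (3 * Num.sqrt 3) * (q ^+ 2 * q) * (4 * c ^+ 3 - 3 * c) =
  (8 / (3 * Num.sqrt 3) * c ^+ 3 - 2 / Num.sqrt 3 * c) * q ^+ 3.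
  by field; rewrite gt_eqF.
have -> : 8 / (3 * Num.sqrt 3) = (2 / Num.sqrt 3) ^+ 3 :> R.
  have -> : 8 / (3 * Num.sqrt 3) = 8 / (Num.sqrt 3 ^+ 2 * Num.sqrt 3) :> R by rewrite s3.
  by field; rewrite gt_eqF.
ring.
Qed.

Lemma topev_eigenvector : exists2 v, sqn v = 1 & v *m S = topev S *: v.
Proof. by apply: unit_eigenvector; rewrite char3 topev_root. Qed.

Let A := (topev S)%:M - S.

Lemma symm_topev : symm A.
Proof. by rewrite /symm linearB /= tr_scalar_mx sS. Qed.

(** The determinant is the characteristic cubic at its root [topev S], and the sum of minors is the
    derivative 3 t^2 - J2 of the cubic there, equal to J2 (4 cos^2 - 1), which is nonnegative
    because the cosine is at least 1/2. *)
Lemma topev_psd_coefs :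
  [/\ det3 (A 0 0) (A 1 1) (A 2 2) (A 0 1) (A 0 2) (A 1 2) = 0,
      0 <= A 0 0 + A 1 1 + A 2 2 &
      0 <= (A 0 0 * A 1 1 - A 0 1 ^+ 2) + (A 0 0 * A 2 2 - A 0 2 ^+ 2) +
           (A 1 1 * A 2 2 - A 1 2 ^+ 2)].
Proof.
split.
- by rewrite -(det3E symm_topev) char3 topev_root.
- have -> : A 0 0 + A 1 1 + A 2 2 = 3 * topev S by rewrite !mxE S22 /=; ring.
  have /andP[c0 _] := cos_lode_bound.
  have c1 : 0 <= cos (lode S) by lra.
  by rewrite mulr_ge0// /topev !mulr_ge0 ?invr_ge0 ?sqrtr_ge0.
- set e2 := (X in 0 <= X); have -> : e2 = 3 * topev S ^+ 2 - J2 S.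
    by rewrite /e2 !mxE /= /J2 dev_traceless fdotE3 (sE 1 0) (sE 2 0) (sE 2 1) S22; field.
  rewrite topev_sqr; have /andP[c0 _] := cos_lode_bound.
  have : 1 / 4 <= cos (lode S) ^+ 2 by nra.
  have := J2_ge0; nra.
Qed.

Lemma quadf_scalar v : quadf A v = topev S * sqn v - quadf S v.
Proof.
rewrite /quadf /A fdotDl fdotNl; congr (_ - _).
by rewrite -scalemx1 fdotZl fdot_Id3_outer.
Qed.

Lemma quadf_le_topev v : quadf S v <= topev S * sqn v.
Proof.
have [D s1 s2] := topev_psd_coefs.
by rewrite -subr_ge0 -quadf_scalar quadfE ?psd3//; exact: symm_topev.
Qed.

(** A vector that is nearly a top eigenvector has a quadratically small gap. C depends on S, through
    its spectral gaps, but the bound holds whatever the multiplicity of the top eigenvalue. *)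
Lemma topev_gap_le : exists2 C, 0 < C & forall v,
  topev S * sqn v - quadf S v <= C * sqn (v *m A).
Proof.
have [D s1 s2] := topev_psd_coefs.
have [C C0 HC] := psd3_le_sqr D s1 s2; exists C => // v.
have aE i j : A i j = A j i by rewrite -[in LHS]symm_topev mxE.
rewrite -quadf_scalar quadfE ?sqnE; last exact: symm_topev.
apply: le_trans (HC _ _ _) _; rewrite ler_pM2l// ![(v *m A) _ _]mxE !sum3E.
rewrite (aE 1 0) (aE 2 0) (aE 2 1) !(mulrC (v _ _)) lexx//.
Qed.

End Traceless.
End TopEigenvalue.

(** * Norm and largest eigenvalue of the deviator as functions of the stress *)

Section Deviator.
Context {R : realType}.
Implicit Types (X Y S : 'M[R]_3).

Lemma presD X Y : pres (X + Y) = pres X + pres Y.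
Proof. by rewrite /pres fdotDr mulrDl. Qed.

Lemma presZ a X : pres (a *: X) = a * pres X.
Proof. by rewrite /pres fdotZr mulrA. Qed.

Lemma pres_Id3 : pres (Id3 R) = 1.
Proof. by rewrite /pres fdot_Id3_Id3 divff ?pnatr_eq0. Qed.

Lemma devD X Y : dev (X + Y) = dev X + dev Y.
Proof. by rewrite /dev presD scalerDl opprD addrACA. Qed.

Lemma devZ a X : dev (a *: X) = a *: dev X.
Proof. by rewrite /dev presZ scalerBr scalerA. Qed.

Lemma dev_Id3 : dev (Id3 R) = 0.
Proof. by rewrite /dev pres_Id3 scale1r subrr. Qed.

Lemma fdot_Id3_dev X : fdot (Id3 R) (dev X) = 0.
Proof. by rewrite /dev !fdotE fdot_Id3_Id3 /pres divfK ?pnatr_eq0// subrr. Qed.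

Lemma dev_dev X : dev (dev X) = dev X.
Proof. exact/dev_traceless/fdot_Id3_dev. Qed.

Lemma symm_dev X : symm X -> symm (dev X).
Proof. by move=> sX; rewrite /dev; apply/symmD/symmN/symmZ/symm_Id3. Qed.

(** Symmetrizing first makes the deviator symmetric on all matrices, so that the spectral results
    apply on the whole normed space; on symmetric matrices it is [dev]. *)
Definition symdev X : 'M[R]_3 := dev (2^-1 *: (X + X^T)).

Lemma symdev_is_linear : linear symdev.
Proof.
move=> a X Y; rewrite /symdev -devZ -devD; congr dev.
by rewrite linearP /= addrACA -(scalerDr a) [LHS]scalerDr !scalerA (mulrC a).
Qed.

HB.instance Definition _ :=
  GRing.isLinear.Build R 'M[R]_3 'M[R]_3 _ symdev symdev_is_linear.

Lemma symdevB X Y : symdev (X - Y) = symdev X - symdev Y.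
Proof. exact: linearB. Qed.

Lemma symm_symdev X : symm (symdev X).
Proof. by apply/symm_dev/symmZ; rewrite /symm linearD /= trmxK addrC. Qed.

Lemma fdot_Id3_symdev X : fdot (Id3 R) (symdev X) = 0.
Proof. exact: fdot_Id3_dev. Qed.

Lemma symdevE X : symm X -> symdev X = dev X.
Proof.
move=> sX; rewrite /symdev sX; have -> : X + X = 2 *: X by rewrite scaler_nat mulr2n.
by rewrite scalerA mulVf ?scale1r ?pnatr_eq0.
Qed.

Lemma lode_dev X : lode (dev X) = lode X.
Proof. by rewrite /lode /J3 /J2 dev_dev. Qed.

Lemma lodeZ t X : 0 < t -> lode (t *: X) = lode X.
Proof.
move=> t0; rewrite /lode /J3 /J2 devZ -!scalemxAl -!scalemxAr. rewrite -?scalemxAl !fdotZl ?fdotZr.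
set a := fdot _ (Id3 R); set q := fdot _ _; congr (acos _ / 3).
have -> : t * (t * q) / 2 = t ^+ 2 * (q / 2) by ring.
rewrite sqrtrM ?sqr_ge0// sqrtr_sqr gtr0_norm//.
have -> : t ^+ 2 * (q / 2) * (t * Num.sqrt (q / 2)) = t ^+ 3 * (q / 2 * Num.sqrt (q / 2)).
  by ring.
rewrite invfM; move: (_ * Num.sqrt (q / 2))^-1 => i.
have -> : t * (t * (t * a)) = t ^+ 3 * a by ring.
by field; rewrite gt_eqF.
Qed.

Definition srho X : R := fnorm (symdev X).

Lemma srho_ge0 X : 0 <= srho X.
Proof. exact: fnorm_ge0. Qed.

Lemma symdev_eq0 X : srho X = 0 -> symdev X = 0.
Proof. exact: fnorm_eq0. Qed.

Lemma symdev_bounded : exists C : R, 0 < C /\ forall X, fnorm (symdev X) <= C * `|X|.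
Proof.
exists (3 * (\sum_(i < 3) \sum_(j < 3) `|symdev (delta_mx i j)|) + 1); split.
  by rewrite ltr_wpDl// mulr_ge0//; apply: sumr_ge0 => i _; apply: sumr_ge0 => j _.
move=> X; apply: le_trans (fnorm_le_mx_norm _) _.
have := mx3_linear_bounded symdev X; have := normr_ge0 X => /=; lra.
Qed.

Definition symdev_bound : R := projT1 (cid symdev_bounded).

Lemma symdev_bound_gt0 : 0 < symdev_bound.
Proof. exact: (projT2 (cid symdev_bounded)).1. Qed.

Lemma fnorm_symdev X : fnorm (symdev X) <= symdev_bound * `|X|.
Proof. exact: (projT2 (cid symdev_bounded)).2. Qed.

Lemma srho_lip X Y : `|srho X - srho Y| <= symdev_bound * `|X - Y|.
Proof.
have H (U W : 'M[R]_3) : srho U - srho W <= symdev_bound * `|U - W|.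
  rewrite lerBlDr /srho -[U in symdev U](subrK W) linearD /=.
  by apply: le_trans (fnormD _ _) _; rewrite lerD2r fnorm_symdev.
by rewrite ler_norml lerNl opprB H distrC H.
Qed.

Lemma coord_semis (f : {linear 'M[R]_3 -> 'M[R]_3}) i j X :
  semis (fun Y => f Y i j : R^o) X.
Proof.
have lin : linear (fun Y => f Y i j : R^o) by move=> a Y Z; rewrite linearP !mxE.
pose g := GRing.isLinear.Build R 'M[R]_3 R^o _ _ lin.
pose h : {linear 'M[R]_3 -> R^o} := HB.pack (fun Y => f Y i j : R^o) g.
exact: (mx3_linear_semis h).
Qed.

Lemma srho_semis X : 0 < srho X -> semis (srho : _ -> R^o) X.
Proof.
move=> X0; apply: (@semis_comp _ _ _ _ (fun Y => fdot (symdev Y) (symdev Y) : R^o)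
  (fun y : R^o => Num.sqrt y : R^o)).
  apply: semis_sum => i; apply: semis_sum => j.
  by apply: semisM; exact: coord_semis.
by apply: semis_sqrt; rewrite -sqr_fnorm exprn_gt0.
Qed.

Definition slam X : R := topev (symdev X).

(** Index set of the linear functionals, X to v X v^T, whose maximum is the largest eigenvalue. *)
Definition unitv := {v : 'rV[R]_3 | sqn v = 1}.

Lemma quadf_le_fnorm S (v : unitv) : quadf S (sval v) <= fnorm S.
Proof.
apply: le_trans (fdot_le _ _) _; rewrite {2}/fnorm fdot_outer (svalP v).
by rewrite expr1n sqrtr1 mulr1.
Qed.

Lemma slam_max X : exists v : unitv, quadf (symdev X) (sval v) = slam X.
Proof.
have [v v1 vS] := topev_eigenvector (symm_symdev X) (fdot_Id3_symdev X).
by exists (exist _ v v1); rewrite (quadf_eigen vS) v1 mulr1.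
Qed.

Lemma quadf_le_slam X (v : unitv) : quadf (symdev X) (sval v) <= slam X.
Proof.
have := quadf_le_topev (symm_symdev X) (fdot_Id3_symdev X) (sval v).
by rewrite (svalP v) mulr1.
Qed.

Let ql (v : unitv) X : R := quadf (symdev X) (sval v).

Let qlD v X Y a : ql v (X + a *: Y) = ql v X + a * ql v Y.
Proof. by rewrite /ql /quadf linearD linearZ fdotDl fdotZl. Qed.

Let qlC v h : ql v h <= symdev_bound * `|h|.
Proof. exact: le_trans (quadf_le_fnorm _ _) (fnorm_symdev _). Qed.

Lemma slam_lip X Y : `|slam X - slam Y| <= symdev_bound * `|X - Y|.
Proof.
exact: (@max_linear_lip _ _ _ ql slam symdev_bound qlD qlC
  (fun v X => quadf_le_slam X v) slam_max).
Qed.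

Lemma eigenvector_shift (v : 'rV[R]_3) (P Q : 'M[R]_3) t s : v *m Q = s *: v ->
  v *m (t%:M - P) = (t - s) *: v + v *m (Q - P).
Proof.
by move=> E; rewrite !mulmxBr E mul_mx_scalar scalerBl addrA subrK.
Qed.

(* At a unit top eigenvector v of Y, the quadratic form of A = slam X - X is at
   most C |A v|^2, and A v = (slam X - slam Y) v + (Y - X) v is of order |Y - X|. *)
Lemma slam_gap X : exists2 C, 0 < C & forall Y, exists2 v : unitv,
  ql v Y = slam Y & slam X - ql v X <= C * `|Y - X| ^+ 2.
Proof.
have [C C0 HC] := topev_gap_le (symm_symdev X) (fdot_Id3_symdev X).
(* In each coordinate, one [symdev_bound] comes from the difference of eigenvalues and three from
   the product of v with a column; the three squared coordinates give 3 K^2. *)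
have [K K0 KE] : exists2 K, 0 < K & K = 4 * symdev_bound.
  by exists (4 * symdev_bound) => //; rewrite mulr_gt0 ?symdev_bound_gt0.
exists (C * (3 * K ^+ 2)); first by apply: (mulr_gt0 C0); rewrite mulr_gt0// exprn_gt0.
move=> Y; have [v v1 vY] := topev_eigenvector (symm_symdev Y) (fdot_Id3_symdev Y).
exists (exist _ v v1); first by rewrite /ql (quadf_eigen vY) v1 mulr1.
have := HC v; rewrite v1 mulr1 => H; apply: (le_trans H).
rewrite -mulrA ler_pM2l// sqnE.
have vle j : `|v 0 j| <= 1.
  rewrite -(@ler_sqr _ `|_|) ?nnegrE// expr1n real_normK ?num_real// -v1 /sqn.
  by rewrite (bigD1 j)//= lerDl sumr_ge0// => k _; exact: sqr_ge0.
have bound j : (v *m ((topev (symdev X))%:M - symdev X)) 0 j ^+ 2 <= K ^+ 2 * `|Y - X| ^+ 2.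
  rewrite -exprMn -[leLHS]real_normK ?num_real// ler_sqr ?nnegrE ?mulr_ge0 ?(ltW K0)//.
  have -> : v *m ((topev (symdev X))%:M - symdev X) =
      (slam X - slam Y) *: v + v *m symdev (Y - X).
    by rewrite symdevB; exact: eigenvector_shift.
  rewrite 2!mxE; apply: le_trans (ler_normD _ _) _.
  have H1 : `|(slam X - slam Y) * v 0 j| <= symdev_bound * `|Y - X|.
    rewrite normrM (distrC Y) -[leRHS]mulr1.
    by rewrite ler_pM// slam_lip.
  have H2 k : `|v 0 k * symdev (Y - X) k j| <= symdev_bound * `|Y - X|.
    rewrite normrM -[leRHS]mul1r ler_pM//.
    exact: le_trans (normr_coord_fnorm _ _ _) (fnorm_symdev _).
  have H3 : `|(v *m symdev (Y - X)) 0 j| <= 3 * (symdev_bound * `|Y - X|).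
    rewrite mxE sum3E; apply: le_trans (ler_normD _ _) _.
    apply: le_trans (lerD (ler_normD _ _) (lexx _)) _.
    have := H2 0; have := H2 1; have := H2 2; lra.
  rewrite KE; lra.
have := bound 0; have := bound 1; have := bound 2; lra.
Qed.

Lemma slam_semis X : semis (slam : _ -> R^o) X.
Proof.
have [C C0 HC] := slam_gap X.
have M1 : symdev_bound <= Num.max symdev_bound C by rewrite le_max lexx.
have M2 : C <= Num.max symdev_bound C by rewrite le_max lexx orbT.
apply: (@semis_max_linear _ _ _ ql slam (Num.max symdev_bound C)) => //.
- by rewrite lt_max C0 orbT.
- by move=> v h; apply: le_trans (qlC v h) _; rewrite ler_wpM2r.
- by move=> v Y; exact: quadf_le_slam.
- exact: slam_max.
- move=> Y; have [v v1 v2] := HC Y; exists v => //.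
  by apply: (le_trans v2); rewrite ler_wpM2r ?exprn_ge0.
Qed.

End Deviator.

(** * Homogeneous functions near the hydrostatic axis *)

Section Cones.
Context {R : realType} {V W : normedModType R}.
Variables (F : V -> W) (z0 : V).
Hypothesis F0 : F z0 = 0.
Hypothesis Fcone : forall t h, 0 < t -> F (z0 + t *: h) = t *: F (z0 + h).

Lemma cone_dirderiv h : dirderiv F z0 h (F (z0 + h)).
Proof.
move=> e e0; exists 1 => // t t0 _.
by rewrite Fcone// F0 subr0 subrr normr0 mulr_ge0// ltW.
Qed.

(** Along the ray from the apex z0 through y, F is linear, so F'(y; y - z0) = F y exactly. Only
    Lipschitz continuity and directional differentiability remain to be supplied. *)
Lemma semis_cone r C : 0 < r -> 0 < C -> lip_on F z0 r C ->
  (forall y h, `|y - z0| < r -> exists d, dirderiv F y h d) -> semis F z0.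
Proof.
move=> r0 C0 L D; exists r, C; split=> //; split=> // y yr; split=> [h|]; first exact: D.
exists (F y); last by rewrite F0 subr0 subrr normr0 mulr_ge0 ?exprn_ge0// ltW.
move=> e e0; exists 1 => // t t0 _.
have t1 : 0 < 1 + t by rewrite addr_gt0.
have -> : y + t *: (y - z0) = z0 + (1 + t) *: (y - z0).
  by rewrite scalerDl scale1r addrA [z0 + _]addrC subrK.
rewrite Fcone// [z0 + _]addrC subrK scalerDl scale1r [F y + _]addrC addrK subrr normr0.
by rewrite mulr_ge0// ltW.
Qed.

End Cones.

(** * Functions of the direction of the deviator *)

Section Angular.
Context {R : realType}.
Implicit Types (W : normedModType R) (X Y : 'M[R]_3).

Lemma symdev_shift X0 X t : srho X0 = 0 -> symdev (X0 + t *: X) = t *: symdev X.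
Proof. by move=> X00; rewrite linearD linearZ /= (symdev_eq0 X00) add0r. Qed.

Lemma srho_shift X0 X t : srho X0 = 0 -> 0 < t -> srho (X0 + t *: X) = t * srho X.
Proof. by move=> X00 t0; rewrite /srho symdev_shift// fnormZ gtr0_norm. Qed.

(* A bounded function of the Lode angle and the direction of the deviator: w may
   be discontinuous where srho vanishes, but srho X *: w X is Lipschitz. *)
Record angular W (w : 'M[R]_3 -> W) (C : R) : Prop := Angular {
  angular_bound : forall X, `|w X| <= C;
  angular_lip : forall X Y, 0 < srho X -> 0 < srho Y ->
    srho Y * `|w X - w Y| <= C * `|X - Y|;
  angular_shift : forall X0 X t, srho X0 = 0 -> 0 < t -> w (X0 + t *: X) = w X;
  angular_semis : forall X, 0 < srho X -> semis w X }.

Lemma angular_cst W (c : W) : angular (fun=> c) `|c|.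
Proof.
split=> // [X Y _ _|X _]; last exact: semis_cst.
by rewrite subrr normr0 mulr0 mulr_ge0.
Qed.

(** With w = symdev / rho, rho_Y (w X - w Y) = (rho_Y - rho_X) w X + (symdev X - symdev Y), and both
    terms are controlled by Lipschitz functions. On the axis 1/0 = 0 keeps w bounded. *)
Lemma angular_dir : angular (fun X => (srho X)^-1 *: symdev X) (1 + 2 * symdev_bound).
Proof.
have C0 := @symdev_bound_gt0 R.
have n1 (X : 'M[R]_3) : `|(srho X)^-1 *: symdev X| <= 1.
  rewrite normrZ normfV ger0_norm ?srho_ge0//; have [->|X0] := eqVneq (srho X) 0.
    by rewrite invr0 mul0r.
  have Xp : 0 < srho X by rewrite lt_neqAle eq_sym X0 srho_ge0.
  by rewrite mulrC ler_pdivrMr// mul1r; exact: mx_norm_le_fnorm.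
split=> [X|X Y X0 Y0|X0 X t X00 t0|X X0].
- by apply: le_trans (n1 X) _; lra.
- have -> : srho Y * `|(srho X)^-1 *: symdev X - (srho Y)^-1 *: symdev Y| =
    `|(srho Y - srho X) *: ((srho X)^-1 *: symdev X) + (symdev X - symdev Y)|.
    have E (Z : 'M[R]_3) : 0 < srho Z -> srho Z *: ((srho Z)^-1 *: symdev Z) = symdev Z.
      by move=> Z0; rewrite scalerA mulfV ?scale1r// gt_eqF.
    rewrite -{1}(gtr0_norm Y0) -normrZ; congr `|_|.
    by rewrite scalerBr scalerBl (E X X0) (E Y Y0) addrA subrK.
  apply: le_trans (ler_normD _ _) _; rewrite normrZ.
  have H1 := srho_lip Y X; rewrite (distrC Y) in H1.
  have H2 : `|symdev X - symdev Y| <= symdev_bound * `|X - Y|.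
    by rewrite -symdevB; apply: le_trans (mx_norm_le_fnorm _) (fnorm_symdev _).
  have H3 := ler_pM (normr_ge0 _) (normr_ge0 _) H1 (n1 X).
  have := normr_ge0 (X - Y); lra.
- rewrite srho_shift// symdev_shift// scalerA invfM.
  by rewrite mulrAC mulVf ?mul1r// gt_eqF.
- apply: semisZ; last exact: mx3_linear_semis.
  apply: (semis_comp (srho_semis X0) (g := fun y : R^o => y^-1 : R^o)).
  by apply: semis_inv; rewrite gt_eqF.
Qed.

Definition clode X : R := cos (lode (symdev X)).

Lemma clode_bound X : 1 / 2 <= clode X <= 1.
Proof. exact: cos_lode_bound (symm_symdev X) (fdot_Id3_symdev X). Qed.

Let kap : R := 2 / Num.sqrt 3 / Num.sqrt 2.

Let kap0 : 0 < kap.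
Proof. by rewrite !divr_gt0// sqrtr_gt0. Qed.

(** Since J2 = rho^2 / 2, Viete's formula becomes this product. Read off the axis as cos (theta) =
    slam / (kap rho), it eliminates the arccosine. *)
Lemma slamE X : slam X = kap * srho X * clode X.
Proof.
rewrite /slam /topev /clode; congr (_ * _); rewrite /J2 dev_traceless ?fdot_Id3_symdev//.
by rewrite sqrtrM ?fdot_sqr_ge0// sqrtrV// -/(fnorm _) /kap /srho; ring.
Qed.

Lemma angular_clode : angular (clode : _ -> R^o) (1 + symdev_bound + symdev_bound / kap).
Proof.
have C0 := @symdev_bound_gt0 R; have Ck : 0 < symdev_bound / kap by rewrite divr_gt0.
have n1 (X : 'M[R]_3) : `|clode X| <= 1.
  by have := clode_bound X; rewrite ler_norml; lra.
have E (X : 'M[R]_3) : 0 < srho X -> clode X = kap^-1 * ((srho X)^-1 * slam X).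
  have E4 (k a c : R) : k != 0 -> a != 0 -> c = k^-1 * (a^-1 * (k * a * c)).
    by move=> k0 a0; field; rewrite k0 a0.
  by move=> X0; rewrite slamE; apply: E4; rewrite gt_eqF.
split=> [X|X Y X0 Y0|X0 X t X00 t0|X X0].
- by apply: (le_trans (n1 X)); lra.
- have -> : srho Y * `|clode X - clode Y| =
     `|(srho Y - srho X) * clode X + (slam X - slam Y) / kap|.
    rewrite -{1}(gtr0_norm Y0) -normrM; congr `|_|.
    have E3 (k a b c d : R) : k != 0 -> a * (c - d) = (a - b) * c + (k * b * c - k * a * d) / k.
      by move=> k0; field.
    by rewrite !slamE; apply: E3; rewrite gt_eqF.
  apply: le_trans (ler_normD _ _) _; rewrite 2!normrM normfV (gtr0_norm kap0).
  have H1 := srho_lip Y X; rewrite (distrC Y) in H1.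
  have H2 : `|slam X - slam Y| / kap <= symdev_bound * `|X - Y| / kap.
    by rewrite ler_pM2r ?invr_gt0// slam_lip.
  have H3 := ler_pM (normr_ge0 _) (normr_ge0 _) H1 (n1 X).
  have := normr_ge0 (X - Y); lra.
- rewrite /clode symdev_shift//; congr cos.
  exact: lodeZ.
- have [r r0 Hr] : exists2 r : R, 0 < r & forall Y : 'M[R]_3, `|Y - X| < r -> 0 < srho Y.
    exists (srho X / symdev_bound); first by rewrite divr_gt0.
    move=> Y YX; have {}YX : `|Y - X| * symdev_bound < srho X by rewrite -ltr_pdivlMr.
    have := srho_lip X Y.
    by have := ler_norm (srho X - srho Y); rewrite (distrC X); lra.
  apply: (@semis_near _ _ _ _ (fun Y => kap^-1 * ((srho Y)^-1 * slam Y) : R^o) _ _ r0).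
    by move=> Y /Hr /E.
  apply: semisM; first exact: semis_cst.
  apply: semisM; last exact: slam_semis.
  apply: (semis_comp (srho_semis X0) (g := fun y : R^o => y^-1 : R^o)).
  by apply: semis_inv; rewrite gt_eqF.
Qed.

Lemma angular_comp (f : R -> R) C B :
  0 <= C -> (forall a, 1 / 2 <= a <= 1 -> `|f a| <= B) ->
  (forall a b, 1 / 2 <= a <= 1 -> 1 / 2 <= b <= 1 -> `|f a - f b| <= C * `|a - b|) ->
  (forall a, 1 / 2 <= a <= 1 -> semis (f : R^o -> R^o) a) ->
  exists2 K, 0 < K & angular ((fun X => f (clode X)) : _ -> R^o) K.
Proof.
move=> C0 fB fC fS; have [_ cL cS cD] := angular_clode.
set K := 1 + symdev_bound + _ in cL.
have K0 : 0 < K by rewrite /K; have := @symdev_bound_gt0 R; have := divr_gt0 (@symdev_bound_gt0 R) kap0; lra.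
have B0 : 0 <= B.
  by apply: le_trans (fB 1 _) => //; lra.
have CK := mulr_ge0 C0 (ltW K0).
exists (1 + B + C * K); first lra.
split=> [X|X Y X0 Y0|X0 X t X00 t0|X X0].
- by apply: (le_trans (fB _ (clode_bound X))); lra.
- apply: (@le_trans _ _ (C * (K * `|X - Y|))).
    apply: le_trans (ler_wpM2l C0 (cL _ _ X0 Y0)).
    rewrite mulrCA ler_wpM2l ?srho_ge0//; apply: fC; exact: clode_bound.
  rewrite mulrA ler_wpM2r//; lra.
- by rewrite /= cS.
- exact: semis_comp (cD X X0) (fS _ (clode_bound X)).
Qed.

(* The deviatoric part of the returned stress has this form, with b the rate at which
   the multiplier z.1 shrinks the deviator; it vanishes in the apex regime. *)
Section ConeCutoff.
Variables (W : normedModType R) (w : 'M[R]_3 -> W) (C : R).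
Hypothesis C0 : 0 < C.
Hypothesis wC : angular w C.

Definition cutoff (b : R) (z : R^o * 'M[R]_3) : W :=
  pospart (srho z.2 - b * pospart z.1) *: w z.2.

Lemma cutoff0 b (z : R^o * 'M[R]_3) : 0 <= b -> srho z.2 = 0 -> cutoff b z = 0.
Proof.
move=> b0 z0; rewrite /cutoff z0 ler0_pospart ?scale0r//.
by rewrite sub0r oppr_le0 mulr_ge0 ?pospart_ge0.
Qed.

Let cut_le b (z : R^o * 'M[R]_3) : 0 <= b -> pospart (srho z.2 - b * pospart z.1) <= srho z.2.
Proof.
move=> b0; rewrite -[leRHS](ger0_pospart (srho_ge0 _)); apply: pospart_homo.
by rewrite gerDl oppr_le0 mulr_ge0 ?pospart_ge0.
Qed.

Let n1 (z : R^o * 'M[R]_3) : `|z.1| <= `|z|.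
Proof. by rewrite prod_normE le_max lexx. Qed.

Let n2 (z : R^o * 'M[R]_3) : `|z.2| <= `|z|.
Proof. by rewrite prod_normE le_max lexx orbT. Qed.

(** If one point is on the axis, its value is 0 and the other is at most C [srho]. Otherwise P w -
    P' w' = (P - P') w + P' (w - w'), and P' <= [srho z'.2] absorbs the weight in [angular_lip]. *)
Lemma cutoff_lip b z z' : 0 <= b ->
  `|cutoff b z - cutoff b z'| <= (C * (symdev_bound + b) + C) * `|z - z'|.
Proof.
move=> b0; have S0 := @symdev_bound_gt0 R.
have Cb := mulr_ge0 (ltW C0) b0; have CS := mulr_ge0 (ltW C0) (ltW S0).
have half y y' : srho y'.2 = 0 ->
    `|cutoff b y - cutoff b y'| <= (C * (symdev_bound + b) + C) * `|y - y'|.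
  move=> y0; rewrite (cutoff0 b0 y0) subr0 normrZ ger0_norm ?pospart_ge0//.
  have H1 := ler_pM (pospart_ge0 _) (normr_ge0 _) (cut_le y b0) (angular_bound wC y.2).
  apply: (le_trans H1); have := srho_lip y.2 y'.2; rewrite y0 subr0 ger0_norm ?srho_ge0//.
  move=> H2; have H3 := n2 (y - y').
  have H4 : srho y.2 * C <= symdev_bound * `|y - y'| * C.
    rewrite ler_pM2r//; apply: (le_trans H2).
    by rewrite ler_pM2l//.
  apply: (le_trans H4); have := normr_ge0 (y - y') => nn.
  have := mulr_ge0 Cb nn; have := mulr_ge0 (ltW C0) nn; lra.
have [z0|z0] := eqVneq (srho z'.2) 0; first exact: half.
have [z1|z1] := eqVneq (srho z.2) 0.
  by rewrite distrC (distrC z); exact: half.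
have p0 : 0 < srho z'.2 by rewrite lt_neqAle eq_sym z0 srho_ge0.
have p1 : 0 < srho z.2 by rewrite lt_neqAle eq_sym z1 srho_ge0.
rewrite /cutoff; set P := pospart _; set P' := pospart _.
have -> : P *: w z.2 - P' *: w z'.2 = (P - P') *: w z.2 + P' *: (w z.2 - w z'.2).
  by rewrite scalerBl scalerBr; zmod_ring.
apply: le_trans (ler_normD _ _) _; rewrite !normrZ (mulrDl (C * _)); apply: lerD.
  rewrite -mulrA mulrC; apply: ler_pM => //; first exact: angular_bound wC _.
  apply: (le_trans (pospart_lip _ _)).
  have -> : srho z.2 - b * pospart z.1 - (srho z'.2 - b * pospart z'.1) =
    (srho z.2 - srho z'.2) - b * (pospart z.1 - pospart z'.1) by ring.
  apply: (le_trans (ler_normB _ _)); rewrite normrM (ger0_norm b0) mulrDl lerD//.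
    by apply: (le_trans (srho_lip _ _)); rewrite ler_pM2l//; exact: (n2 (z - z')).
  by rewrite ler_wpM2l//; apply: (le_trans (pospart_lip _ _)); exact: (n1 (z - z')).
apply: (@le_trans _ _ (C * `|z.2 - z'.2|)); last by rewrite ler_pM2l//; exact: (n2 (z - z')).
apply: le_trans (angular_lip wC p1 p0); rewrite ler_wpM2r//.
by rewrite ger0_norm ?pospart_ge0// cut_le.
Qed.

Lemma cutoff_semis_pos b (z : R^o * 'M[R]_3) : 0 < srho z.2 -> semis (cutoff b) z.
Proof.
move=> z0; have S2 := semis_snd z.
apply: semisZ; last exact: (semis_comp S2 (angular_semis wC z0)).
apply: (semis_comp (g := pospart : R^o -> R^o)); last exact: semis_pospart.
apply: semisB; first exact: (semis_comp S2 (srho_semis z0)).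
apply: semisM; first exact: semis_cst.
exact: (semis_comp (semis_fst z) (semis_pospart _)).
Qed.

(** Homogeneity about z requires the threshold [b * pospart z.1] to scale as well, hence the
    alternative b = 0 or z.1 = 0. *)
Lemma cutoff_cone b (z : R^o * 'M[R]_3) : 0 <= b -> b = 0 \/ z.1 = 0 -> srho z.2 = 0 ->
  forall t h, 0 < t -> cutoff b (z + t *: h) = t *: cutoff b (z + h).
Proof.
move=> b0 bz z0 t h t0; rewrite /cutoff /= srho_shift//.
have -> : z.2 + h.2 = z.2 + 1 *: h.2 by rewrite scale1r.
rewrite srho_shift// mul1r !(angular_shift wC _ z0)// scalerA -pospartM ?ltW//.
congr (pospart _ *: _); case: bz => [->|->]; first by ring.
by rewrite !add0r /GRing.scale /= pospartM ?ltW//; ring.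
Qed.

Lemma cutoff_semis_zero (z : R^o * 'M[R]_3) : semis (cutoff 0) z.
Proof.
have [z0|z0] := eqVneq (srho z.2) 0; last first.
  by apply: cutoff_semis_pos; rewrite lt_neqAle eq_sym z0 srho_ge0.
have L0 : 0 < C * (symdev_bound + 0) + C by rewrite addr0 addr_gt0// mulr_gt0// symdev_bound_gt0.
apply: (semis_cone (cutoff0 (lexx 0) z0) (cutoff_cone (lexx 0) (or_introl erefl) z0) ltr01 L0).
  by move=> y y' _ _; exact: cutoff_lip.
move=> y h _; have [y0|y0] := eqVneq (srho y.2) 0; last first.
  by apply/semis_ddiff/cutoff_semis_pos; rewrite lt_neqAle eq_sym y0 srho_ge0.
eexists; apply: cone_dirderiv; first exact: cutoff0.
by apply: cutoff_cone => //; left.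
Qed.

(** On the axis, if z.1 < 0 the threshold vanishes nearby and [cutoff 0] takes over; if z.1 > 0 it
    exceeds [srho] nearby and the function is 0; if z.1 = 0 the function is a cone. The first two
    cases also supply directional derivatives near the cone point, so they are settled before it. *)
Lemma cutoff_semis b (z : R^o * 'M[R]_3) : 0 < b -> semis (cutoff b) z.
Proof.
move=> b0; have S0 := @symdev_bound_gt0 R; have bp := ltW b0.
have L0 : 0 < C * (symdev_bound + b) + C by rewrite addr_gt0// mulr_gt0// addr_gt0.
have neg (y : R^o * 'M[R]_3) : y.1 < 0 -> semis (cutoff b) y.
  move=> y0; have k0 : 0 < - y.1 by rewrite oppr_gt0.
  apply: (semis_near k0) (cutoff_semis_zero y) => u uy.
  have u0 : u.1 < 0.
    by have := le_lt_trans (n1 (u - y)) uy; rewrite /= ltr_distl => /andP[_]; lra.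
  by rewrite /cutoff (ler0_pospart (ltW u0)) mulr0 mul0r.
have pos (y : R^o * 'M[R]_3) : 0 < y.1 -> srho y.2 = 0 -> semis (cutoff b) y.
  move=> y0 y1; pose r := Num.min (y.1 / 2) (b * y.1 / 2 / symdev_bound).
  have r0 : 0 < r by rewrite lt_min !divr_gt0// mulr_gt0.
  apply: (semis_near r0) (semis_cst 0 y) => u; rewrite lt_min => /andP[u1 u2].
  have H1 : y.1 / 2 <= u.1.
    by have := le_lt_trans (n1 (u - y)) u1; rewrite /= ltr_distl => /andP[+ _]; lra.
  have H2 : srho u.2 <= b * (y.1 / 2).
    have := le_lt_trans (n2 (u - y)) u2; rewrite ltr_pdivlMr// => H2.
    have := srho_lip u.2 y.2; rewrite y1 subr0 ger0_norm ?srho_ge0//; move: H2 => /=; lra.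
  rewrite /cutoff ler0_pospart ?scale0r// ger0_pospart; last by lra.
  by rewrite subr_le0; apply: (le_trans H2); rewrite ler_pM2l.
have [z0|z0] := eqVneq (srho z.2) 0; last first.
  by apply: cutoff_semis_pos; rewrite lt_neqAle eq_sym z0 srho_ge0.
have [z1|z1|z1] := ltgtP z.1 0; [exact: neg|exact: pos|].
apply: (semis_cone (cutoff0 bp z0) (cutoff_cone bp (or_intror z1) z0) ltr01 L0).
  by move=> y y' _ _; exact: cutoff_lip.
move=> y h _; have [y0|y0] := eqVneq (srho y.2) 0; last first.
  by apply/semis_ddiff/cutoff_semis_pos; rewrite lt_neqAle eq_sym y0 srho_ge0.
have [y1|y1|y1] := ltgtP y.1 0; [exact/semis_ddiff/neg|exact/semis_ddiff/pos|].
eexists; apply: cone_dirderiv; first exact: cutoff0.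
by apply: cutoff_cone => //; right.
Qed.

End ConeCutoff.
End Angular.

(** * The Willam-Warnke function *)

Section WillamWarnke.
Context {R : realType}.
Variable e : R.
Hypothesis e_ge : 1 / 2 <= e.
Hypothesis e_le : e <= 1.

Let g : R := 2 * e - 1.
Let k : R := 4 * (1 - e ^+ 2).
Let q (c : R) : R := Num.sqrt (k * c ^+ 2 + 5 * e ^+ 2 - 4 * e).

Definition ww_num (c : R) : R := k * c ^+ 2 + g ^+ 2.
Definition ww_den (c : R) : R := k / 2 * c + g * q c.

Lemma r_eE c : r_e e c = ww_num c / ww_den c.
Proof.
rewrite /r_e /ww_num /ww_den /q /k /g; congr (_ / (_ * c + _)).
by field.
Qed.

Let g0 : 0 <= g.
Proof. by rewrite /g; have := e_ge; lra. Qed.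

Let g1 : g <= 1.
Proof. by rewrite /g; have := e_le; lra. Qed.

Let e_sqr : 1 / 4 <= e ^+ 2 <= 1.
Proof.
have h1 := e_ge; have h2 := e_le.
have H1 : 0 <= (e - 1 / 2) * (e + 1 / 2) by apply: mulr_ge0; lra.
have H2 : 0 <= (1 - e) * (1 + e) by apply: mulr_ge0; lra.
by apply/andP; split; lra.
Qed.

Let k0 : 0 <= k. Proof. by rewrite /k; case/andP: e_sqr; lra. Qed.
Let k3 : k <= 3. Proof. by rewrite /k; case/andP: e_sqr; lra. Qed.

(** At c = 1/2 the radicand is exactly (2 e - 1)^2, and it does not decrease beyond. *)
Let arg_ge c : 1 / 2 <= c -> g ^+ 2 <= k * c ^+ 2 + 5 * e ^+ 2 - 4 * e.
Proof.
move=> c2; have : k * (1 / 4) <= k * c ^+ 2 by rewrite ler_wpM2l//; nra.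
rewrite /k /g; lra.
Qed.

Let q_ge c : 1 / 2 <= c -> g <= q c.
Proof. by move=> /arg_ge H; rewrite -(ger0_norm g0) -sqrtr_sqr ler_wsqrtr. Qed.

(** The lower bound k/4 + g^2 = 3 e^2 - 4 e + 2 has its minimum 2/3 at e = 2/3. *)
Lemma ww_den_ge c : 1 / 2 <= c -> 2 / 3 <= ww_den c.
Proof.
move=> c2; have H1 := ler_wpM2l g0 (q_ge c2).
have H2 : k / 2 * (1 / 2) <= k / 2 * c by rewrite ler_wpM2l// divr_ge0.
have : 2 / 3 <= k / 4 + g * g by rewrite /k /g; have := sqr_ge0 (3 * e - 2); lra.
rewrite /ww_den; lra.
Qed.

Lemma ww_num_bound c : 1 / 2 <= c <= 1 -> 0 <= ww_num c <= 4.
Proof.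
move=> /andP[c2 c1]; have H1 := mulr_ge0 k0 (sqr_ge0 c); have H2 := sqr_ge0 g.
have H3 : k * c ^+ 2 <= 3 * 1 by rewrite ler_pM ?sqr_ge0//; nra.
have H4 : g ^+ 2 <= 1 by have := g0; have := g1; nra.
by rewrite /ww_num; lra.
Qed.

Lemma r_e_bound c : 1 / 2 <= c <= 1 -> 0 <= r_e e c <= 6.
Proof.
move=> cc; have /andP[n0 n1] := ww_num_bound cc; have /andP[c2 _] := cc.
have d0 := ww_den_ge c2; have dp : 0 < ww_den c by lra.
rewrite r_eE; apply/andP; split; first by apply: divr_ge0 => //; exact: ltW.
by rewrite ler_pdivrMr//; lra.
Qed.

Let kD_bound a b : 1 / 2 <= a -> a <= 1 -> 1 / 2 <= b -> b <= 1 ->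
  `|k * (a + b)| <= 6.
Proof.
move=> a2 a1 b2 b1; have ab : 0 <= a + b by lra.
have ab2 : a + b <= 2 by lra.
rewrite ger0_norm; last exact: (mulr_ge0 k0 ab).
by apply: le_trans (ler_pM k0 ab k3 ab2) _; lra.
Qed.

Lemma ww_num_lip a b : 1 / 2 <= a <= 1 -> 1 / 2 <= b <= 1 ->
  `|ww_num a - ww_num b| <= 6 * `|a - b|.
Proof.
move=> /andP[a2 a1] /andP[b2 b1].
have -> : ww_num a - ww_num b = k * (a + b) * (a - b) by rewrite /ww_num; ring.
by rewrite normrM ler_wpM2r// kD_bound.
Qed.

(** For e = 1/2 the root q vanishes at c = 1/2 and is not uniformly Lipschitz as e approaches 1/2;
    its factor g repairs this, because g <= q gives 2 g |q a - q b| <= |q a^2 - q b^2|. *)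
Lemma ww_den_lip a b : 1 / 2 <= a <= 1 -> 1 / 2 <= b <= 1 ->
  `|ww_den a - ww_den b| <= 5 * `|a - b|.
Proof.
move=> /andP[a2 a1] /andP[b2 b1].
have qa := q_ge a2; have qb := q_ge b2.
have sq c : 1 / 2 <= c -> q c ^+ 2 = k * c ^+ 2 + 5 * e ^+ 2 - 4 * e.
  by move=> /arg_ge H; rewrite sqr_sqrtr//; have := sqr_ge0 g; lra.
have H : 2 * (g * `|q a - q b|) <= 6 * `|a - b|.
  apply: (@le_trans _ _ ((q a + q b) * `|q a - q b|)).
    by rewrite mulrA ler_wpM2r//; lra.
  have ab0 : 0 <= q a + q b by have := g0; lra.
  rewrite -{1}(ger0_norm ab0) -normrM.
  have -> : (q a + q b) * (q a - q b) = k * (a + b) * (a - b).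
    have -> : (q a + q b) * (q a - q b) = q a ^+ 2 - q b ^+ 2 by ring.
    by rewrite !sq//; ring.
  by rewrite normrM ler_wpM2r// kD_bound.
have -> : ww_den a - ww_den b = k / 2 * (a - b) + g * (q a - q b).
  by rewrite /ww_den; ring.
apply: (le_trans (ler_normD _ _)); rewrite (normrM _ (a - b)) (normrM g) (ger0_norm g0).
rewrite (ger0_norm (divr_ge0 k0 _))//.
have : k / 2 * `|a - b| <= 3 / 2 * `|a - b| by rewrite ler_wpM2r//; have := k3; lra.
have := normr_ge0 (a - b); lra.
Qed.

Lemma r_e_lip a b : 1 / 2 <= a <= 1 -> 1 / 2 <= b <= 1 ->
  `|r_e e a - r_e e b| <= 60 * `|a - b|.
Proof.
move=> aa bb; have /andP[na na4] := ww_num_bound aa; have /andP[nb nb4] := ww_num_bound bb.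
have /andP[a2 _] := aa; have /andP[b2 _] := bb.
have da := ww_den_ge a2; have db := ww_den_ge b2.
have da0 : 0 < ww_den a by lra.
have db0 : 0 < ww_den b by lra.
have /andP[rb0 rb6] := r_e_bound bb.
(* The quotient is thereby bounded by (6 + 6 * 5) / (2/3) = 54 times |a - b|. *)
have E : r_e e a - r_e e b =
    ((ww_num a - ww_num b) - r_e e b * (ww_den a - ww_den b)) / ww_den a.
  by rewrite !r_eE; field; rewrite !gt_eqF.
rewrite E normrM normfV (gtr0_norm da0) ler_pdivrMr//.
apply: (le_trans (ler_normB _ _)); rewrite normrM (ger0_norm rb0).
have H1 := ww_num_lip aa bb; have H2 := ww_den_lip aa bb.
have H3 : r_e e b * `|ww_den a - ww_den b| <= 6 * (5 * `|a - b|) by rewrite ler_pM.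
have H4 : 2 / 3 * `|a - b| <= ww_den a * `|a - b| by rewrite ler_wpM2r.
have := normr_ge0 (a - b); lra.
Qed.

Lemma r_e_semis a : 1 / 2 <= a <= 1 -> semis (r_e e : R^o -> R^o) a.
Proof.
move=> /andP[a2 _].
apply: (semis_ext (G := fun c : R^o => ww_num c * (ww_den c)^-1 : R^o)) => [c|].
  exact: r_eE.
have sid := @semis_id R R^o a.
have sk (c : R^o) : semis (fun=> c : R^o) (a : R^o) by exact: semis_cst.
have s2 : semis (fun c : R^o => k * c ^+ 2 : R^o) a.
  by apply: semisM => //; exact: semisX.
apply: semisM; first by apply: semisD => //.
apply: (semis_comp (f := ww_den : R^o -> R^o) (g := fun y : R^o => y^-1 : R^o)).
  apply: semisD; first exact: semisM.
  (* For g = 0 the radicand may vanish, but the square root then has coefficient 0; for g > 0 the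
     radicand is at least g^2. *)
  have [gz|gn] := eqVneq g 0.
    by apply: semis_ext (semis_cst (0 : R^o) _) => c; rewrite gz mul0r.
  have gp : 0 < g ^+ 2 by rewrite exprn_gt0// lt_neqAle eq_sym gn g0.
  apply: semisM => //.
  apply: (semis_comp (f := fun c : R^o => k * c ^+ 2 + 5 * e ^+ 2 - 4 * e : R^o)
     (g := fun y : R^o => Num.sqrt y : R^o)).
    by apply: semisB => //; apply: semisD.
  by apply: semis_sqrt; apply: lt_le_trans gp (arg_ge a2).
by apply: semis_inv; rewrite gt_eqF//; have := ww_den_ge a2; lra.
Qed.

End WillamWarnke.

(** * The return mapping *)

Section ReturnMapping.
Context {R : realType}.
Notation M := 'M[R]_3.
Variables K G m0 Ag Bg fc ft e : R.
Hypotheses (K_gt0 : 0 < K) (G_gt0 : 0 < G) (m0_gt0 : 0 < m0) (Ag_gt0 : 0 < Ag).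
Hypotheses (Bg_gt0 : 0 < Bg) (fc_gt0 : 0 < fc) (e_ge : 1 / 2 <= e) (e_le : e <= 1).

Let s6 : R := Num.sqrt 6.
Let s6_gt0 : 0 < s6.
Proof. by rewrite sqrtr_gt0. Qed.

(** Per unit multiplier, the mean stress drops by [vol_flow] and the norm of the deviator by
    [dev_flow] plus 6 G / fc^2 times itself. The latter term, moved to the left of the flow rule,
    becomes the factor [softening]. *)
Definition vol_flow (p : R) : R := K * mg' Ag Bg fc ft p / fc.
Definition dev_flow : R := 2 * G * (m0 / (s6 * fc)).
Definition softening (l : R) : R := 1 + 6 * G / fc ^+ 2 * pospart l.
(* In the functions of z below, z.1 is the mean stress of the returned stress and z.2 the
   trial stress. The multiplier is negative if z.1 exceeds the mean stress of z.2, and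
   its positive part is the one of the system. *)
Definition multiplier (z : R^o * M) : R^o := (pres z.2 - z.1) / vol_flow z.1.
Definition radius (X : M) : R := r_e e (clode X).
(** The radius is that of the trial stress, as scaling the deviator keeps the Lode angle. It enters
    as the weight of a [cutoff] because it is not continuous on the axis by itself. *)
Definition yieldp (z : R^o * M) : R^o :=
  fhat m0 fc z.1 (cutoff (fun=> 1 : R^o) dev_flow (multiplier z, z.2) / softening (multiplier z))
    (cutoff (radius : M -> R^o) dev_flow (multiplier z, z.2) / softening (multiplier z)).
Definition sdir (X : M) : M := (srho X)^-1 *: symdev X.
Definition ret_dev (z : R^o * M) : M :=
  (softening (multiplier z))^-1 *: cutoff sdir dev_flow (multiplier z, z.2).

Let c6 : R := 6 * G / fc ^+ 2.
Let c6_gt0 : 0 < c6.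
Proof. by apply: divr_gt0; [apply: mulr_gt0|apply: exprn_gt0]. Qed.

Lemma dev_flow_gt0 : 0 < dev_flow.
Proof. by apply: mulr_gt0; [apply: mulr_gt0|apply: divr_gt0 => //; apply: mulr_gt0]. Qed.

Lemma vol_flow_gt0 p : 0 < vol_flow p.
Proof. by apply: divr_gt0 => //; apply: mulr_gt0 => //; apply: mulr_gt0 => //; exact: expR_gt0. Qed.

Lemma vol_flow_homo p p' : p <= p' -> vol_flow p <= vol_flow p'.
Proof.
move=> pp; rewrite ler_pM2r ?invr_gt0// ler_pM2l// ler_pM2l// ler_expR.
by rewrite ler_pM2r ?invr_gt0 ?mulr_gt0// lerD2r.
Qed.

Lemma softening_ge1 l : 1 <= softening l.
Proof. by rewrite lerDl; apply: mulr_ge0; [exact: ltW|exact: pospart_ge0]. Qed.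

Lemma softening_gt0 l : 0 < softening l.
Proof. exact: lt_le_trans (softening_ge1 l). Qed.

Lemma radius_ge0 X : 0 <= radius X.
Proof. by have /andP[] := r_e_bound e_ge e_le (clode_bound X). Qed.

Lemma angular_one : exists2 C : R, 0 < C & angular (fun=> 1 : R^o) C.
Proof. by exists `|1|; [rewrite normr1|exact: angular_cst]. Qed.

Lemma angular_sdir : exists2 C : R, 0 < C & angular sdir C.
Proof.
exists (1 + 2 * symdev_bound); last exact: angular_dir.
by have := @symdev_bound_gt0 R; lra.
Qed.

Lemma angular_radius : exists2 C : R, 0 < C & angular (radius : M -> R^o) C.
Proof.
apply: (@angular_comp _ (r_e e) 60 6) => //.
- by move=> a /(r_e_bound e_ge e_le); rewrite ler_norml; lra.
- by move=> a b; exact: r_e_lip.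
- by move=> a; exact: r_e_semis.
Qed.

Lemma pres_semis X : semis (@pres R : M -> R^o) X.
Proof.
apply: semisM; last exact: semis_cst.
apply: semis_sum => i; apply: semis_sum => j; apply: semisM; first exact: semis_cst.
exact: (coord_semis idfun).
Qed.

Lemma vol_flow_semis p : semis (vol_flow : R^o -> R^o) p.
Proof.
apply: semisM; last exact: semis_cst.
apply: semisM; first exact: semis_cst.
apply: semisM; first exact: semis_cst.
apply: (semis_comp (f := fun p : R^o => (p - ft / 3) / (Bg * fc) : R^o)
  (g := fun y : R^o => expR y : R^o)); last exact: semis_exp.
apply: semisM; last exact: semis_cst.
by apply: semisB; [exact: semis_id|exact: semis_cst].
Qed.

Lemma multiplier_semis z : semis multiplier z.
Proof.
apply: semisM.
  apply: semisB; last exact: semis_fst.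
  exact: (semis_comp (semis_snd z) (pres_semis _)).
apply: (semis_comp (f := fun z : R^o * M => vol_flow z.1 : R^o) (g := fun y : R^o => y^-1 : R^o)).
  exact: (semis_comp (semis_fst z) (vol_flow_semis _)).
by apply: semis_inv; rewrite gt_eqF// vol_flow_gt0.
Qed.

Lemma softeningV_semis z : semis (fun z => (softening (multiplier z))^-1 : R^o) z.
Proof.
apply: (semis_comp (f := fun z : R^o * M => softening (multiplier z) : R^o) (g := fun y : R^o => y^-1 : R^o)).
  apply: semisD; first exact: semis_cst.
  apply: semisM; first exact: semis_cst.
  exact: (semis_comp (multiplier_semis z) (semis_pospart _)).
by apply: semis_inv; rewrite gt_eqF// softening_gt0.
Qed.

Lemma cutoff_multiplier_semis (W : normedModType R) (w : M -> W) z :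
  (exists2 C : R, 0 < C & angular w C) ->
  semis (fun z => cutoff w dev_flow (multiplier z, z.2)) z.
Proof.
move=> [C C0 wC].
apply: (semis_comp (semis_pair (multiplier_semis z) (semis_snd z)) (g := cutoff w dev_flow)).
by apply: (cutoff_semis C0 wC); exact: dev_flow_gt0.
Qed.

Lemma yieldp_semis z : semis yieldp z.
Proof.
have scl (c : R) : semis (fun=> c : R^o) z by exact: semis_cst.
have s1 := cutoff_multiplier_semis z angular_one; have s2 := cutoff_multiplier_semis z angular_radius.
have sV := softeningV_semis z.
apply: semisB => //; apply: semisD.
  by apply: semisM => //; apply: semisX; apply: semisM => //; exact: semisM.
apply: semisM => //; apply: semisD; apply: semisM => //; first exact: semisM.
exact: semis_fst.
Qed.

Lemma ret_dev_semis z : semis ret_dev z.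
Proof. exact: semisZ (softeningV_semis z) (cutoff_multiplier_semis z angular_sdir). Qed.

Lemma multiplier_pospart_homo (X : M) (p p' : R) : p <= p' ->
  pospart (multiplier (p' : R^o, X)) <= pospart (multiplier (p : R^o, X)).
Proof.
move=> pp; rewrite /multiplier /= !(mulrC (pres X - _)).
rewrite !pospartM ?invr_ge0 ?(ltW (vol_flow_gt0 _))//.
apply: ler_pM; rewrite ?pospart_ge0 ?invr_ge0 ?(ltW (vol_flow_gt0 _))//.
  by rewrite lef_pV2 ?posrE ?vol_flow_gt0// vol_flow_homo.
by apply: pospart_homo; lra.
Qed.

Definition ret_rho (z : R^o * M) : R :=
  pospart (srho z.2 - dev_flow * pospart (multiplier z)) / softening (multiplier z).

Lemma yieldpE z : yieldp z = fhat m0 fc z.1 (ret_rho z) (ret_rho z * radius z.2).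
Proof.
rewrite /yieldp /cutoff /ret_rho /=; congr fhat; first by rewrite /GRing.scale /= mulr1.
by rewrite /GRing.scale /= mulrAC.
Qed.

Lemma ret_devE z : ret_dev z = ret_rho z *: sdir z.2.
Proof. by rewrite /ret_dev /cutoff scalerA mulrC. Qed.

Lemma ret_rho_ge0 z : 0 <= ret_rho z.
Proof. by apply: divr_ge0; [exact: pospart_ge0|exact/ltW/softening_gt0]. Qed.

Lemma ret_rho_homo (X : M) (p p' : R) : p <= p' ->
  ret_rho (p : R^o, X) <= ret_rho (p' : R^o, X).
Proof.
move=> /(multiplier_pospart_homo X) H; apply: ler_pM; rewrite ?pospart_ge0//.
- by rewrite invr_ge0 (ltW (softening_gt0 _)).
- by apply: pospart_homo => /=; rewrite lerD2l lerN2 ler_pM2l// dev_flow_gt0.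
- by rewrite lef_pV2 ?posrE ?softening_gt0// lerD2l ler_pM2l.
Qed.

(** The slope comes from the pressure term m0 p / fc. The other terms do not decrease: a larger p
    lowers the positive part of the multiplier and so raises [ret_rho]. *)
Lemma yieldp_mono (X : M) (p p' : R) : p <= p' ->
  m0 / fc * (p' - p) <= yieldp (p' : R^o, X) - yieldp (p : R^o, X).
Proof.
move=> pp; have H := ret_rho_homo X pp; have H0 := ret_rho_ge0 (p : R^o, X).
rewrite !yieldpE /fhat /= -/s6.
move: (ret_rho _) (ret_rho _) (radius X) (radius_ge0 X) H H0 => a b w w0 ba b0.
have i0 : 0 < fc^-1 by rewrite invr_gt0.
have H1 : (b / fc) ^+ 2 <= (a / fc) ^+ 2.
  by rewrite ler_sqr ?nnegrE ?ler_pM2r// divr_ge0 ?(ltW fc_gt0)//; lra.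
have H2 : b * w / (s6 * fc) <= a * w / (s6 * fc).
  by rewrite ler_pM2r ?invr_gt0 ?mulr_gt0// ler_wpM2r.
have H3 : m0 * (b * w / (s6 * fc)) <= m0 * (a * w / (s6 * fc)) by rewrite ler_pM2l.
lra.
Qed.

Lemma yieldp_slope_gt0 : 0 < m0 / fc.
Proof. exact: divr_gt0. Qed.

Lemma yieldp_root (X : M) : exists p : R^o, yieldp (p, X) = 0.
Proof.
apply: (strongly_monotone_root yieldp_slope_gt0) => [p p'|p]; first exact: yieldp_mono.
have [r [C [r0 C0 [L _]]]] := yieldp_semis (p : R^o, X).
exists r, C; split=> // q qr; have := L (q : R^o, X) (p : R^o, X).
by rewrite !prod_normE /= !subrr !normr0 !(max_idPl _)//; apply.
Qed.

Definition proot (X : M) : R^o := projT1 (cid (yieldp_root X)).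

Lemma yieldp_proot X : yieldp (proot X, X) = 0.
Proof. exact: projT2 (cid (yieldp_root X)). Qed.

Lemma proot_uniq X (p : R^o) : yieldp (p, X) = 0 -> p = proot X.
Proof.
move=> Hp; have := strongly_monotone_dist (fun v a b => @yieldp_mono v a b) X p (proot X).
rewrite Hp yieldp_proot subrr normr0 pmulr_rle0 ?yieldp_slope_gt0// normr_le0 subr_eq0.
by move/eqP.
Qed.

Lemma proot_semis X : semis proot X.
Proof.
apply: (semis_implicit yieldp_slope_gt0 (fun v a b => @yieldp_mono v a b)).
  exact: yieldp_proot.
exact: yieldp_semis.
Qed.

(** The coefficient of the identity is the minimum of the trial mean stress and the root. For an
    admissible symmetric trial stress the root is at least the trial mean stress and the formula
    returns X, so no test on the yield function is left. *)
Definition retmap (X : M) : M :=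
  (pres X - pospart (pres X - proot X)) *: Id3 R + ret_dev (proot X, X).

Lemma retmap_semis X : semis retmap X.
Proof.
have sp := pres_semis X; have sr := proot_semis X.
apply: semisD; last exact: (semis_comp (semis_pair sr (semis_id X)) (ret_dev_semis _)).
apply: semisZ; last exact: semis_cst.
apply: semisB => //.
exact: (semis_comp (semisB sp sr) (semis_pospart _)).
Qed.

(** * Solutions of the return-mapping system *)

Section Solutions.
Variable X : M.
Hypothesis sX : symm X.

Lemma srhoE (s : M) : symm s -> srho s = rho s.
Proof. by move=> ss; rewrite /srho symdevE. Qed.

Lemma clodeE (s : M) : symm s -> clode s = cos (lode s).
Proof. by move=> ss; rewrite /clode (symdevE ss) lode_dev. Qed.

Lemma rho_eE (s : M) : symm s -> rho_e e s = srho s * radius s.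
Proof.
move=> ss; rewrite /rho_e -srhoE//; case: ifPn => [s0|].
  by rewrite /radius (clodeE ss).
by rewrite lt_def srho_ge0 andbT negbK => /eqP ->; rewrite mul0r.
Qed.

Lemma fhat_sE (s : M) : symm s -> fhat_s m0 fc e s = fhat m0 fc (pres s) (srho s) (srho s * radius s).
Proof. by move=> ss; rewrite /fhat_s rho_eE// srhoE. Qed.

Lemma ret_rho_elastic (p : R) : pres X <= p -> ret_rho (p : R^o, X) = srho X.
Proof.
move=> ap; have l0 : pospart (multiplier (p : R^o, X)) = 0.
  apply: ler0_pospart; rewrite /multiplier /= pmulr_lle0 ?invr_gt0 ?vol_flow_gt0//; lra.
by rewrite /ret_rho /softening l0 !mulr0 addr0 subr0 divr1 ger0_pospart ?srho_ge0.
Qed.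

Lemma srho_sdir : srho X *: sdir X = dev X.
Proof.
rewrite /sdir scalerA -symdevE//; have [X0|X0] := eqVneq (srho X) 0.
  by rewrite X0 mul0r scale0r symdev_eq0.
by rewrite mulfV// scale1r.
Qed.

Lemma retmap_elastic : fhat_s m0 fc e X <= 0 -> retmap X = X.
Proof.
move=> f0; have ap : pres X <= proot X.
  rewrite leNgt; apply/negP => pa; have := yieldp_mono X (ltW pa).
  rewrite yieldp_proot subr0 yieldpE ret_rho_elastic//= -fhat_sE// => H.
  have := mulr_gt0 yieldp_slope_gt0 (_ : 0 < pres X - proot X); rewrite subr_gt0 => /(_ pa).
  by move: H f0; lra.
rewrite /retmap ler0_pospart; last by lra.
by rewrite subr0 ret_devE ret_rho_elastic// srho_sdir /dev addrC subrK.
Qed.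

Let l (p : R) : R := multiplier (p : R^o, X).
Let ret (p : R) : M := p *: Id3 R + ret_dev (p : R^o, X).

Let symm_sdir : symm (sdir X).
Proof. by apply: symmZ; exact: symm_symdev. Qed.

Let fdot_sdir : fdot (Id3 R) (sdir X) = 0.
Proof. by rewrite /sdir fdotZr fdot_Id3_symdev mulr0. Qed.

Lemma symm_ret p : symm (ret p).
Proof. by apply: symmD; [apply: symmZ; exact: symm_Id3|rewrite ret_devE; exact: symmZ]. Qed.

Lemma pres_ret p : pres (ret p) = p.
Proof. by rewrite presD presZ pres_Id3 mulr1 ret_devE /pres fdotZr fdot_sdir mulr0 mul0r addr0. Qed.

Lemma dev_ret p : dev (ret p) = ret_rho (p : R^o, X) *: sdir X.
Proof. by rewrite /dev pres_ret [ret p]addrC addrK ret_devE. Qed.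

Lemma ret_rho_srho0 p : srho X = 0 -> ret_rho (p : R^o, X) = 0.
Proof.
move=> X0; rewrite /ret_rho X0 ler0_pospart ?mul0r// sub0r oppr_le0.
by apply: mulr_ge0; [exact: ltW dev_flow_gt0|exact: pospart_ge0].
Qed.

Lemma fnorm_sdir : srho X != 0 -> fnorm (sdir X) = 1.
Proof.
move=> X0; rewrite /sdir fnormZ normfV ger0_norm ?srho_ge0//.
by rewrite -/(srho X) mulVf.
Qed.

Lemma srho_ret p : srho (ret p) = ret_rho (p : R^o, X).
Proof.
rewrite srhoE; last exact: symm_ret.
rewrite /rho dev_ret fnormZ ger0_norm ?ret_rho_ge0//.
have [X0|X0] := eqVneq (srho X) 0; first by rewrite ret_rho_srho0 ?mul0r.
by rewrite fnorm_sdir ?mulr1.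
Qed.

Lemma clode_ret p : ret_rho (p : R^o, X) != 0 -> clode (ret p) = clode X.
Proof.
move=> r0; have X0 : srho X != 0 by apply: contra r0 => /eqP X0; rewrite ret_rho_srho0.
have rp : 0 < ret_rho (p : R^o, X) by rewrite lt_def r0 ret_rho_ge0.
have Xp : 0 < srho X by rewrite lt_def X0 srho_ge0.
rewrite (clodeE (symm_ret p)) -lode_dev dev_ret (lodeZ _ rp) /sdir lodeZ ?invr_gt0//.
Qed.

(** The Lode angle survives the positive scaling of the deviator; at the apex, where the radii of
    [ret p] and X may differ, both are multiplied by 0. *)
Lemma fhat_ret p : fhat_s m0 fc e (ret p) = yieldp (p : R^o, X).
Proof.
have Wg (a b c : R) : (a != 0 -> b = c) -> a * b = a * c.
  by have [->|a0 ->//] := eqVneq a 0; rewrite !mul0r.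
have W : ret_rho (p : R^o, X) * radius (ret p) = ret_rho (p : R^o, X) * radius X.
  apply: Wg => r0.
  exact: (congr1 (r_e e) (clode_ret r0)).
by rewrite (fhat_sE (symm_ret p)) pres_ret srho_ret W yieldpE.
Qed.

Let A (r : R) : R := 2 * G * (3 * r / fc ^+ 2 + m0 / (Num.sqrt 6 * fc)).

Let AE r : A r = c6 * r + dev_flow.
Proof. by rewrite /A /c6 /dev_flow /s6; field; rewrite !gt_eqF// sqrtr_gt0. Qed.

Let l_ge0 p : p <= pres X -> 0 <= l p.
Proof. by move=> pa; apply: divr_ge0; [rewrite subr_ge0|exact/ltW/vol_flow_gt0]. Qed.

Let flow_pres p : pres X - l p * vol_flow p = p.
Proof. by rewrite /l /multiplier /= divfK ?gt_eqF ?vol_flow_gt0//; ring. Qed.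

Lemma ret_rho_eq p : p <= pres X ->
  ret_rho (p : R^o, X) * (1 + c6 * l p) = pospart (srho X - dev_flow * l p).
Proof.
move=> pa; rewrite /ret_rho /softening -/(l p) (ger0_pospart (l_ge0 pa)) /= divfK//.
by rewrite gt_eqF// ltr_pwDl// mulr_ge0 ?(ltW c6_gt0) ?l_ge0.
Qed.

(** The flow rule holds for every p up to the trial mean stress; the yield condition then selects
    p. *)
Lemma ret_flow p : p <= pres X -> exists n, subrho (ret p) n /\
  ret p = X - l p *: ((K * mg' Ag Bg fc ft (pres (ret p)) / fc) *: Id3 R
                      + A (rho (ret p)) *: n).
Proof.
move=> pa; rewrite pres_ret -/(vol_flow p) -srhoE; last exact: symm_ret.
rewrite /subrho -srhoE; last exact: symm_ret.
rewrite srho_ret; have E := ret_rho_eq pa; have l0 := l_ge0 pa.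
have XE : X = pres X *: Id3 R + dev X by rewrite /dev addrC subrK.
suff [n [Hn Hd]] : exists n, (if 0 < ret_rho (p : R^o, X) then
    n = (ret_rho (p : R^o, X))^-1 *: dev (ret p)
    else symm n /\ fdot (Id3 R) n = 0 /\ fnorm n <= 1) /\
    ret_rho (p : R^o, X) *: sdir X = dev X - (l p * A (ret_rho (p : R^o, X))) *: n.
  have XB u v : X - (u + v) = (pres X *: Id3 R - u) + (dev X - v).
    by rewrite addrACA -XE opprD.
  exists n; split=> //; rewrite scalerDr !scalerA XB /ret ret_devE Hd; congr (_ + _).
  by rewrite -scalerBl flow_pres.
rewrite AE; have [r0|r0] := boolP (0 < ret_rho (p : R^o, X)).
  exists (sdir X); split.
    by rewrite dev_ret scalerA mulVf ?scale1r// gt_eqF.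
  rewrite -srho_sdir -scalerBl; congr (_ *: _).
  have P0 : 0 < srho X - dev_flow * l p.
    rewrite ltNge; apply/negP => P0; move: E; rewrite ler0_pospart// => /eqP.
    by rewrite mulf_eq0 (gt_eqF r0) gt_eqF// ltr_pwDl// mulr_ge0 ?(ltW c6_gt0).
  by move: E; rewrite ger0_pospart ?(ltW P0)//; lra.
have r1 : ret_rho (p : R^o, X) = 0.
  by apply/eqP; rewrite eq_le ret_rho_ge0 andbT leNgt.
have P0 : srho X <= dev_flow * l p.
  rewrite leNgt; apply/negP => P0; move: E; rewrite r1 mul0r ger0_pospart; lra.
(* At the apex the flow has to cancel the whole deviator, which forces this direction; it has norm
   at most 1 because [srho X <= dev_flow * l p]. If [l p = 0], the deviator is zero and so is the
   direction. *)
exists ((l p * dev_flow)^-1 *: dev X); split; last first.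
  rewrite r1 mulr0 add0r scale0r scalerA.
  have [lz|lz] := eqVneq (l p) 0.
    rewrite lz !mul0r scale0r subr0 -symdevE// symdev_eq0//.
    by apply/eqP; rewrite eq_le srho_ge0 andbT; move: P0; rewrite lz mulr0.
  by rewrite mulfV ?scale1r ?subrr// mulf_neq0// gt_eqF ?dev_flow_gt0.
split; first by apply: symmZ; exact: symm_dev.
split; first by rewrite fdotZr fdot_Id3_dev mulr0.
have sl : 0 <= l p * dev_flow by apply: mulr_ge0 => //; exact/ltW/dev_flow_gt0.
rewrite fnormZ normfV ger0_norm// -symdevE// -/(srho X).
have [->|z] := eqVneq (l p * dev_flow) 0; first by rewrite invr0 mul0r.
by rewrite mulrC ler_pdivrMr ?lt_def ?z// mul1r mulrC.
Qed.

(** Conversely, the spherical part of the flow rule determines the multiplier from the mean stress.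
    In the deviatoric part, if rho s > 0 then n is also the direction of [dev X], and the norms give
    [ret_rho]; if rho s = 0 then |n| <= 1 makes the positive part vanish. *)
Lemma rm_system_ret s dl : rm_system K G m0 Ag Bg fc ft e X s dl ->
  [/\ pres s <= pres X, dl = l (pres s) & s = ret (pres s)].
Proof.
move=> [ss [[n [Hn sE]] [dl0 _]]].
have sE' : s = pres s *: Id3 R + dev s by rewrite /dev addrC subrK.
have nI : fdot (Id3 R) n = 0.
  move: Hn; rewrite /subrho; case: ifP => _; last by case=> _ [].
  by move=> ->; rewrite fdotZr fdot_Id3_dev mulr0.
have pn : pres n = 0 by rewrite /pres nI mul0r.
have dn : dev n = n by exact: dev_traceless.
have pE : pres X - pres s = dl * vol_flow (pres s).
  have := congr1 (@pres R) sE; rewrite -scaleNr presD presZ presD !presZ pres_Id3 pn.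
  rewrite -/(vol_flow (pres s)); lra.
have dE : dev X = dev s + (dl * A (rho s)) *: n.
  have := congr1 (@dev R) sE; rewrite -scaleNr devD devZ devD !devZ dev_Id3 dn.
  by rewrite scaler0 add0r scaleNr scalerA -/(A _) => ->; rewrite subrK.
have k0 := vol_flow_gt0 (pres s).
have pa : pres s <= pres X by rewrite -subr_ge0 pE mulr_ge0// ltW.
have dlE : dl = l (pres s) by rewrite /l /multiplier /= pE mulfK// gt_eqF.
split=> //; rewrite [LHS]sE' /ret; congr (_ + _); rewrite ret_devE /=.
have E := ret_rho_eq pa; rewrite -dlE in E.
have N0 : 0 < 1 + c6 * dl by rewrite ltr_pwDl// mulr_ge0// ltW.
have r0 : 0 <= rho s := fnorm_ge0 _.
move: Hn dE; rewrite /subrho AE; case: ifPn => [rp nE|rn [sn [_ n1]]] dE.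
  have ds : dev s = rho s *: n by rewrite nE scalerA mulfV ?scale1r// gt_eqF.
  have fn : fnorm n = 1.
    by rewrite nE fnormZ normfV (gtr0_norm rp) -/(rho s) mulVf// gt_eqF.
  have t0 : 0 < rho s + dl * (c6 * rho s + dev_flow).
    rewrite ltr_pwDl// mulr_ge0// addr_ge0 ?(ltW dev_flow_gt0)// mulr_ge0// ltW//.
  have Xn : dev X = (rho s + dl * (c6 * rho s + dev_flow)) *: n by rewrite dE ds scalerDl.
  have XE : srho X = rho s + dl * (c6 * rho s + dev_flow).
    by rewrite /srho symdevE// Xn fnormZ fn mulr1 gtr0_norm.
  have -> : sdir X = n.
    by rewrite /sdir symdevE// Xn XE scalerA mulVf ?scale1r// gt_eqF.
  rewrite ds; congr (_ *: _).
  have H : srho X - dev_flow * dl = rho s * (1 + c6 * dl) by rewrite XE; ring.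
  move: E; rewrite H ger0_pospart; last by rewrite mulr_ge0// ltW.
  by move/(mulIf (lt0r_neq0 N0)) => ->.
have rz : rho s = 0 by apply/eqP; rewrite eq_le r0 andbT leNgt.
have dz : dev s = 0 by apply: fnorm_eq0.
have -> : ret_rho (pres s : R^o, X) = 0.
  apply: (mulIf (lt0r_neq0 N0)); rewrite mul0r E; apply: ler0_pospart.
  rewrite subr_le0 /srho symdevE// dE dz rz mulr0 !add0r fnormZ.
  rewrite ger0_norm; last by rewrite mulr_ge0// ltW ?dev_flow_gt0.
  rewrite mulrC [leRHS]mulrC -[leRHS]mul1r ler_wpM2r//.
  by rewrite mulr_ge0// ltW ?dev_flow_gt0.
by rewrite dz scale0r.
Qed.

Lemma retmap_plastic : ~ fhat_s m0 fc e X <= 0 ->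
  rm_system K G m0 Ag Bg fc ft e X (retmap X) (l (proot X)) /\
  forall s dl, rm_system K G m0 Ag Bg fc ft e X s dl -> s = retmap X /\ dl = l (proot X).
Proof.
move/negP; rewrite -ltNge => f0.
have fa : yieldp (pres X : R^o, X) = fhat_s m0 fc e X.
  by rewrite yieldpE ret_rho_elastic//= -fhat_sE.
have pa : proot X < pres X.
  rewrite ltNge; apply/negP => ap; have := yieldp_mono X ap.
  rewrite yieldp_proot fa sub0r => H.
  have : 0 <= m0 / fc * (proot X - pres X).
    by apply: mulr_ge0; [exact: ltW yieldp_slope_gt0|rewrite subr_ge0].
  lra.
have rE : retmap X = ret (proot X).
  by rewrite /retmap /ret ger0_pospart ?subr_ge0 ?ltW// subKr.
rewrite rE; split.
  split; first exact: symm_ret.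
  split; first exact: ret_flow (ltW pa).
  split; first exact: l_ge0 (ltW pa).
  by rewrite fhat_ret yieldp_proot mulr0.
move=> s dl Hs; have [ps dlE sE] := rm_system_ret Hs.
have [_ [_ [dl0 [fs dlf]]]] := Hs.
have fE : fhat_s m0 fc e s = yieldp (pres s : R^o, X) by rewrite {1}sE fhat_ret.
suff pE : pres s = proot X by rewrite dlE sE pres_ret pE.
(* By complementarity either the yield function is zero, and the root is unique, or the multiplier
   is zero; the latter gives the trial mean stress, where the yield function is positive. *)
apply: proot_uniq; rewrite -fE; move/eqP: dlf; rewrite mulf_eq0 => /orP[/eqP d0|/eqP//].
have pE : pres s = pres X by have := flow_pres (pres s); rewrite -dlE d0 mul0r subr0.
by move: fs; rewrite fE pE fa leNgt f0.
Qed.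

End Solutions.

Lemma De_semis (epp x : M) : semis (fun eps => De K G (eps - epp)) x.
Proof.
have si : semis (fun eps : M => eps - epp) x.
  by apply: semisD; [exact: semis_id|exact: semis_cst].
apply: (semis_comp si (g := De K G)).
have sp := pres_semis (x - epp).
have Ds : semis (fun Y : M => dev Y) (x - epp).
  apply: semis_ext (semisD (semis_id _) (semisZ (semisN sp) (semis_cst (Id3 R) _))) => Y.
  by rewrite scaleNr.
apply: semisD; apply: semisZ => //; try exact: semis_cst.
apply: semisM; first exact: semis_cst.
apply: semis_ext (semisM sp (semis_cst (3 : R^o) _)) => Y.
by rewrite /pres divfK ?pnatr_eq0.
Qed.

Lemma symm_sig_tr (epp eps : M) : symm epp -> symm eps -> symm (sig_tr K G epp eps).
Proof.
move=> sp se; have sd : symm (eps - epp) by apply: symmD => //; exact: symmN.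
by apply: symmD; apply: symmZ; [exact: symm_Id3|exact: symm_dev].
Qed.

(** In the plastic case uniqueness identifies whichever solution the choice operator picks. *)
Lemma Tmap_retmap (epp eps : M) : symm epp -> symm eps ->
  Tmap K G m0 Ag Bg fc ft e epp eps = retmap (sig_tr K G epp eps).
Proof.
move=> sp se; have sX := symm_sig_tr sp se; rewrite /Tmap.
case: ifPn => [f0|/negP f0]; first by rewrite retmap_elastic.
have [Hr Hu] := retmap_plastic sX f0.
case: pselect => [h|[]]; last by exists (retmap (sig_tr K G epp eps)); eexists; exact: Hr.
by have [dl /Hu[]] := projT2 (cid h).
Qed.

End ReturnMapping.

Theorem theorem7 (R : realType) (K G m0 Ag Bg fc ft e : R) (epp : 'M[R]_3) :
  0 < K -> 0 < G -> 0 < m0 -> 0 < Ag -> 0 < Bg -> 0 < fc -> 0 < ft ->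
  1 / 2 <= e -> e <= 1 -> symm epp ->
  (* well-posedness: in the plastic case the system has a unique solution *)
  (forall eps : 'M[R]_3, symm eps ->
     ~ (fhat_s m0 fc e (sig_tr K G epp eps) <= 0) ->
     exists s dl, rm_system K G m0 Ag Bg fc ft e (sig_tr K G epp eps) s dl /\
       forall s' dl', rm_system K G m0 Ag Bg fc ft e (sig_tr K G epp eps) s' dl' ->
         s' = s /\ dl' = dl) /\
  strongly_semismooth_on_sym (Tmap K G m0 Ag Bg fc ft e epp).
Proof.
move=> K0 G0 m00 Ag0 Bg0 fc0 _ e_ge e_le sp; split.
  move=> eps se f0; have sX := symm_sig_tr K G sp se.
  have [Hr Hu] := retmap_plastic ft K0 G0 m00 Ag0 Bg0 fc0 e_ge e_le sX f0.
  by eexists; eexists; split; [exact: Hr|exact: Hu].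
move=> x sx.
apply: (semis_strongly_semismooth
  (fun y sy => Tmap_retmap ft K0 G0 m00 Ag0 Bg0 fc0 e_ge e_le sp sy) sx).
apply: (semis_comp (De_semis K G epp x)).
exact: retmap_semis.
Qed.
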